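(* For every Adler independence relation $\perp$, the non-dividing independence relation $\perp^{d}$ is stronger than $\perp$: for all small $A,B,C$, $A\perp^{d}_C B$ implies $A\perp_C B$.
   Context: Setting. $T$ is a complete first-order theory with only infinite models in an at most countable language $L$. $\mathbb M$ is a monster model of $T$: for a fixed big enough cardinal $\bar\kappa$ (e.g. strongly inaccessible), $\mathbb M$ is $\bar\kappa^+$-universal, $\bar\kappa$-saturated and strongly $\bar\kappa$-homogeneous. ''Small'' means of cardinality $<\bar\kappa$; all sets and (possibly infinite) tuples of $\mathbb M$ considered are small. Juxtaposition denotes union. $A\equiv_C B$ means $\sigma(A)=B$ for some $\sigma\in \mathrm{Aut}(\mathbb M/C)$; for tuples, $a\equiv_C b$ means $\mathrm{tp}(a/C)=\mathrm{tp}(b/C)$. A ternary relation $\perp$ on small subsets is invariant if $A\perp_C B\iff \sigma(A)\perp_{\sigma(C)}\sigma(B)$ for all $\sigma\in\mathrm{Aut}(\mathbb M)$. An Adler independence relation (AIR) is an invariant relation $\perp$ satisfying: - left and right monotonicity: $AD\perp_C B\Rightarrow A\perp_C B$ and $A\perp_C BD\Rightarrow A\perp_C B$; - right base monotonicity: if $C\subseteq B\subseteq D$ and $A\perp_C D$ then $A\perp_B D$; - left normality: $A\perp_C B\Rightarrow AC\perp_C B$; - left transitivity: if $C\subseteq B\subseteq D$, $B\perp_C A$ and $D\perp_B A$ then $D\perp_C A$; - finite character: if $a\perp_C B$ for all finite $a\subseteq A$ then $A\perp_C B$; - local character: for all $A$ there is a (small) cardinal $\kappa=\kappa(A)$ such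 that for all $B$ there is $B_0\subseteq B$ with $|B_0|<\kappa$ and $A\perp_{B_0}B$; - extension: if $A\perp_C B$ then for any $D\supseteq B$ there is $A'\equiv_{BC}A$ with $A'\perp_C D$. Dividing. A formula $\phi(x,b)$ $k$-divides over $C$ if there is a sequence $(b_i)_{i<\omega}$ of realisations of $\mathrm{tp}(b/C)$ such that $\{\phi(x,b_i): i<\omega\}$ is $k$-inconsistent (any $k$ of them, with distinct indices, are jointly inconsistent); it divides over $C$ if it $k$-divides for some $k$. A partial type divides over $C$ if it implies a formula that divides over $C$. $A\perp^{d}_C B$ means that $\mathrm{tp}(A/BC)$ does not divide over $C$. *)

(* Defs.v *)
From mathcomp Require Import all_boot.
From mathcomp Require Import boolp classical_sets functions cardinality.

Set Implicit Arguments.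
Unset Strict Implicit.
Unset Printing Implicit Defensive.

Local Open Scope classical_set_scope.
Local Open Scope card_scope.

(* Constants are the function symbols of arity 0. *)
Record language := Language {
  func : Type;
  func_arity : func -> nat;
  rel_symb : Type;
  rel_arity : rel_symb -> nat }.

Definition countable_language (L : language) : Prop :=
  countable [set: func L] /\ countable [set: rel_symb L].

Inductive term (L : language) (V : Type) : Type :=
| Var : V -> term L V
| App : forall f : func L, ('I_(func_arity f) -> term L V) -> term L V.
Arguments Var {L V}.
Arguments App {L V}.

(* [formula L V] is the type of formulas with free variables among [V]; the
   quantifier binds the variable [None] of a formula over [option V]. The
   other connectives are the classical abbreviations. *)
Inductive formula (L : language) (V : Type) : Type :=
| Equal : term L V -> term L V -> formula L V
| Rel : forall r : rel_symb L, ('I_(rel_arity r) -> term L V) -> formula L V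
| Bot : formula L V
| Imp : formula L V -> formula L V -> formula L V
| All : formula L (option V) -> formula L V.
Arguments Equal {L V}.
Arguments Rel {L V}.
Arguments Bot {L V}.
Arguments Imp {L V}.
Arguments All {L V}.

Definition Not (L : language) (V : Type) (phi : formula L V) : formula L V :=
  Imp phi Bot.

Definition sentence (L : language) : Type := formula L void.

Record structure (L : language) := Structure {
  carrier :> Type;
  carrier_inhabited : inhabited carrier;
  func_interp : forall f : func L, ('I_(func_arity f) -> carrier) -> carrier;
  rel_interp : forall r : rel_symb L, ('I_(rel_arity r) -> carrier) -> Prop }.
Arguments func_interp {L} s f _.
Arguments rel_interp {L} s r _.

Fixpoint eval (L : language) (M : structure L) (V : Type) (e : V -> M)
    (t : term L V) : M :=
  match t with
  | Var v => e v
  | App f args => func_interp M f (fun i => eval e (args i))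
  end.

Fixpoint sat (L : language) (M : structure L) (V : Type) (phi : formula L V)
    : (V -> M) -> Prop :=
  match phi with
  | Equal s t => fun e => eval e s = eval e t
  | Rel r args => fun e => rel_interp M r (fun i => eval e (args i))
  | Bot => fun=> False
  | Imp psi chi => fun e => sat psi e -> sat chi e
  | All psi => fun e => forall m : M, sat psi (oapp e m)
  end.

Definition holds (L : language) (N : structure L) (phi : sentence L) : Prop :=
  sat phi (of_void N).

Definition model (L : language) (T : set (sentence L)) (N : structure L)
    : Prop :=
  forall phi, T phi -> holds N phi.

Definition entails (L : language) (T : set (sentence L)) (phi : sentence L)
    : Prop :=
  forall N : structure L, model T N -> holds N phi.

Definition complete_theory (L : language) (T : set (sentence L)) : Prop :=
  (exists N : structure L, model T N) /\
  (forall phi, entails T phi \/ entails T (Not phi)).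

Definition only_infinite_models (L : language) (T : set (sentence L)) : Prop :=
  forall N : structure L, model T N -> infinite_set [set: N].

Definition elementary_embedding (L : language) (N M : structure L)
    (f : N -> M) : Prop :=
  forall (n : nat) (phi : formula L 'I_n) (a : 'I_n -> N),
    sat phi a <-> sat phi (f \o a).

Definition partial_elementary (L : language) (M : structure L) (A : set M)
    (f : M -> M) : Prop :=
  forall (n : nat) (phi : formula L 'I_n) (a : 'I_n -> M),
    (forall i, A (a i)) -> (sat phi a <-> sat phi (f \o a)).

Definition automorphism (L : language) (M : structure L) (s : M -> M) : Prop :=
  [/\ bijective s,
      forall (f : func L) a, s (func_interp M f a) = func_interp M f (s \o a)
    & forall (r : rel_symb L) a, rel_interp M r a <-> rel_interp M r (s \o a)].

Definition card_lt (S U : Type) (A : set S) (B : set U) : Prop :=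
  A #<= B /\ ~ (B #<= A).

(* The cardinal kappa-bar is represented as that of a type [K]. *)
Definition small (K U : Type) (A : set U) : Prop := card_lt A [set: K].
Arguments small K {U} A.

(* Uncountable, strong limit and regular. Every cardinal below that of [K] is
   the cardinal of a subset of [K]. *)
Definition strongly_inaccessible (K : Type) : Prop :=
  [/\ card_lt [set: nat] [set: K],
      forall A : set K, small K A -> small K [set X : set K | X `<=` A]
    & forall (I : set K) (F : K -> set K), small K I ->
        (forall i, I i -> small K (F i)) -> small K (\bigcup_(i in I) F i)].

(* The assignment [a] of the variables [X] followed by the parameters [b]. *)
Definition join (X Y U : Type) (a : X -> U) (b : Y -> U) (z : X + Y) : U :=
  match z with inl x => a x | inr y => b y end.

(* Sets of formulas phi(x, d), where x is a tuple of variables indexed by [X]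
   and d is a tuple from [D]. *)
Definition partial_type (L : language) (M : structure L) (X : Type)
    (D : set M) : Type :=
  set (formula L (X + D)).

Definition realises (L : language) (M : structure L) (X : Type) (D : set M)
    (p : partial_type X D) (a : X -> M) : Prop :=
  forall phi, p phi -> sat phi (join a (fun d : D => val d)).

Definition tp (L : language) (M : structure L) (X : Type) (a : X -> M)
    (D : set M) : partial_type X D :=
  [set phi | sat phi (join a (fun d : D => val d))].
Arguments tp {L M X} a D _.

Definition tp_set (L : language) (M : structure L) (A D : set M)
    : partial_type A D :=
  tp (fun x : A => val x) D.
Arguments tp_set {L M} A D _.

Definition finitely_satisfiable (L : language) (M : structure L) (X : Type)
    (D : set M) (p : partial_type X D) : Prop :=
  forall q : partial_type X D, q `<=` p -> finite_set q ->
    exists a : X -> M, realises q a.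

(* kappa-bar^+-universality is about the models of cardinality less than
   kappa-bar^+, that is, at most kappa-bar. *)
Definition universal (L : language) (T : set (sentence L)) (K : Type)
    (M : structure L) : Prop :=
  forall N : structure L, model T N -> [set: N] #<= [set: K] ->
    exists f : N -> M, elementary_embedding f.

Definition saturated (L : language) (K : Type) (M : structure L) : Prop :=
  forall (D : set M) (p : partial_type unit D), small K D ->
    finitely_satisfiable p -> exists a : unit -> M, realises p a.

Definition strongly_homogeneous (L : language) (K : Type) (M : structure L)
    : Prop :=
  forall (A : set M) (f : M -> M), small K A -> partial_elementary A f ->
    exists2 s : M -> M, automorphism s & forall x, A x -> s x = f x.

Definition monster (L : language) (T : set (sentence L)) (K : Type)
    (M : structure L) : Prop :=
  [/\ model T M, universal T K M, saturated K M & strongly_homogeneous K M].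

Definition conjugate_over (L : language) (M : structure L) (C A B : set M)
    : Prop :=
  exists s : M -> M,
    [/\ automorphism s, forall x, C x -> s x = x & s @` A = B].

(* [R A C B] reads: [A] is independent from [B] over [C] (the base is the
   second argument). Only the values of [R] at small sets matter. *)
Definition ternary_relation (L : language) (M : structure L) : Type :=
  set M -> set M -> set M -> Prop.

Section AdlerIndependence.
Variables (L : language) (K : Type) (M : structure L).
Variable (R : ternary_relation M).
Implicit Types A B C D : set M.

Definition invariant_rel : Prop :=
  forall (s : M -> M) A B C, automorphism s ->
    small K A -> small K B -> small K C ->
    (R A C B <-> R (s @` A) (s @` C) (s @` B)).

Definition left_monotonicity : Prop :=
  forall A B C D, small K A -> small K B -> small K C -> small K D ->
    R (A `|` D) C B -> R A C B.

Definition right_monotonicity : Prop :=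
  forall A B C D, small K A -> small K B -> small K C -> small K D ->
    R A C (B `|` D) -> R A C B.

Definition right_base_monotonicity : Prop :=
  forall A B C D, small K A -> small K B -> small K C -> small K D ->
    C `<=` B -> B `<=` D -> R A C D -> R A B D.

Definition left_normality : Prop :=
  forall A B C, small K A -> small K B -> small K C ->
    R A C B -> R (A `|` C) C B.

Definition left_transitivity : Prop :=
  forall A B C D, small K A -> small K B -> small K C -> small K D ->
    C `<=` B -> B `<=` D -> R B C A -> R D B A -> R D C A.

Definition finite_character : Prop :=
  forall A B C, small K A -> small K B -> small K C ->
    (forall a : set M, finite_set a -> a `<=` A -> R a C B) -> R A C B.

(* The cardinal kappa(A) is that of a small subset [S] of [K]. *)
Definition local_character : Prop :=
  forall A, small K A ->
    exists2 S : set K, small K S &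
      forall B, small K B ->
        exists B0 : set M, [/\ B0 `<=` B, card_lt B0 S & R A B0 B].

Definition extension : Prop :=
  forall A B C D, small K A -> small K B -> small K C -> small K D ->
    B `<=` D -> R A C B ->
    exists2 A' : set M, conjugate_over (B `|` C) A' A & R A' C D.

Record adler_independence : Prop := MkAdlerIndependence {
  air_invariant : invariant_rel;
  air_left_monotonicity : left_monotonicity;
  air_right_monotonicity : right_monotonicity;
  air_right_base_monotonicity : right_base_monotonicity;
  air_left_normality : left_normality;
  air_left_transitivity : left_transitivity;
  air_finite_character : finite_character;
  air_local_character : local_character;
  air_extension : extension }.

End AdlerIndependence.
Arguments adler_independence {L} K {M} R.

Section Dividing.
Variables (L : language) (M : structure L).

(* The parameter y of phi(x, y) is an n-tuple; x may be an infinite tuple of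
   variables, of which phi uses only finitely many. *)

Definition k_inconsistent (X : Type) (n : nat) (phi : formula L (X + 'I_n))
    (b : nat -> 'I_n -> M) (k : nat) : Prop :=
  forall u : 'I_k -> nat, injective u ->
    ~ exists a : X -> M, forall i, sat phi (join a (b (u i))).

Definition k_divides (X : Type) (n : nat) (phi : formula L (X + 'I_n))
    (b : 'I_n -> M) (C : set M) (k : nat) : Prop :=
  exists b_ : nat -> 'I_n -> M,
    (forall i, realises (tp b C) (b_ i)) /\ k_inconsistent phi b_ k.

Definition formula_divides (X : Type) (n : nat) (phi : formula L (X + 'I_n))
    (b : 'I_n -> M) (C : set M) : Prop :=
  exists k : nat, k_divides phi b C k.

(* Implication is tested on the tuples of the monster model; by saturation this
   is implication modulo its elementary diagram when [X] and [D] are small. *)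
Definition type_implies (X : Type) (D : set M) (p : partial_type X D)
    (n : nat) (phi : formula L (X + 'I_n)) (b : 'I_n -> M) : Prop :=
  forall a : X -> M, realises p a -> sat phi (join a b).

Definition type_divides (X : Type) (D : set M) (p : partial_type X D)
    (C : set M) : Prop :=
  exists (n : nat) (phi : formula L (X + 'I_n)) (b : 'I_n -> M),
    type_implies p phi b /\ formula_divides phi b C.

Definition nondividing : ternary_relation M :=
  fun A C B => ~ type_divides (tp_set A (B `|` C)) C.

End Dividing.

(* Main.v *)
Require Import Defs.
From Stdlib Require Import Wellfounded.
From mathcomp Require Import all_boot.
From mathcomp Require Import boolp classical_sets functions cardinality.
From mathcomp Require Import wochoice filter.

Set Implicit Arguments.
Unset Strict Implicit.
Unset Printing Implicit Defensive.

Local Open Scope classical_set_scope.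
Local Open Scope card_scope.

(** Let [R] be an Adler independence relation. Everything rests on one principle
    ([indep_of_long_sequence]): to get [R A C B] it is enough to have, for every
    small well-order, a sequence of conjugates [B_i] of [B] over [C] with
    [R (N `|` B_{<i}) C B_i] for some fixed [N] containing [C], and one set [A']
    such that each pair [(A', B_i)] is conjugate to [(A, B)] over [C]. By local
    character [A'] is independent from the whole sequence over a set too small
    to be cofinal in it, hence over [N `|` B_{<i}] for some [i] by base
    monotonicity, and left transitivity brings the base down to [C].

    The principle is used twice.

    - If [tp (a / D)] is finitely satisfiable in [N], a subset of [D], then [R a N D]
      ([coheir_indep]). Extension, which moves the left-hand side, is pulled back
      by an automorphism to move the right-hand side instead; this builds the
      conjugates [D_i] of [D] over [N] by recursion ([independent_sequence]).
      The average of an ultrafilter on tuples of [N] extends [tp (a / D)] to a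
      type that cannot distinguish the [D_i], since it is invariant over [N]; a
      realisation over the union of the [D_i] gives the common [A'].

    - For the theorem, replace [B] by [B `|` C], choose a small elementary [N]
      containing [C] and independent from [B] over [C], and an ultrafilter [U] on
      tuples of [N] with average [tp (B / N)]. By compactness every small linear
      order carries a sequence [c_i] in which, for [i1 < ... < in], a formula
      holds of [c_i1, ..., c_in] when it holds of [f1, ..., fn] for [U]-almost all
      [f1], for [U]-almost all [f2], and so on ([coheir_seq_exists]). This is a
      coheir sequence in reverse order: the terms below [i] are finitely
      satisfiable in [N] over [N] and [c_i], so they are independent from [c_i] over [N]
      by the first use, hence over [C] by transitivity with [R N C c_i].
      The truth of a formula along increasing indices depends only on their
      number, so non-dividing, applied to a sequence indexed by [nat], yields a
      common solution [A'] for a sequence indexed by any order.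

    Reversing the order puts the initial segments on the left of [R], where left
    transitivity needs them, so symmetry of [R] never enters. Taking coheirs makes
    the sequence indiscernible by construction, whereas extracting an indiscernible
    sequence by compactness would not preserve independence from an infinite [B]. *)

(** * Small cardinals *)

Lemma card_leE (T U : Type) (A : set T) (B : set U) :
  A #<= B <-> exists f : A -> B, injective f.
Proof.
split=> [/card_leP[f]|[f finj]].
  by exists f => x y /(@inj _ _ _ f); apply; rewrite inE.
apply/card_leP/injfunPex; exists f => // x y _ _; exact: finj.
Qed.

Lemma card_leTE (T U : Type) (A : set T) :
  A #<= [set: U] <-> exists f : A -> U, injective f.
Proof.
rewrite card_leE; split=> [[f finj]|[f finj]].
  by exists (fun x => val (f x)) => x y /val_inj /finj.
exists (fun x => SigSub (mem_setT (f x))) => x y [] ; exact: finj.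
Qed.

Lemma card_leTT (T U : Type) :
  [set: T] #<= [set: U] <-> exists f : T -> U, injective f.
Proof.
rewrite card_leTE; split=> [[f finj]|[f finj]].
  by exists (fun x => f (SigSub (mem_setT x))) => x y /finj [].
by exists (fun x => f (val x)) => x y /finj /val_inj.
Qed.

Lemma card_leT_inj (T U : Type) (f : T -> U) :
  injective f -> [set: T] #<= [set: U].
Proof. by move=> finj; apply/card_leTT; exists f. Qed.

Section Small.
Variables (K : Type) (HK : strongly_inaccessible K).

Lemma small_le (T U : Type) (A : set T) (B : set U) :
  A #<= B -> small K B -> small K A.
Proof.
move=> AB [BK KB]; split; first exact: card_le_trans BK.
by move=> KA; apply: KB; exact: card_le_trans AB.
Qed.

Lemma small_sub (T : Type) (A B : set T) : A `<=` B -> small K B -> small K A.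
Proof. move=> AB; apply: small_le; exact: subset_card_le. Qed.

Lemma small_image (T U : Type) (f : T -> U) (A : set T) :
  small K A -> small K (f @` A).
Proof. apply: small_le; exact: card_image_le. Qed.

Lemma small_inj (T U : Type) (f : T -> U) :
  injective f -> small K [set: U] -> small K [set: T].
Proof. by move=> finj; apply: small_le; exact: card_leT_inj finj. Qed.

Lemma small_type (T : Type) (A : set T) : small K A <-> small K [set: A].
Proof.
by split; apply: small_le; have := card_setT A; rewrite card_eq_le => /andP[].
Qed.

Lemma small_nat : small K [set: nat].
Proof. by case: HK. Qed.

Lemma small_set (T : Type) : small K [set: T] -> small K [set: set T].
Proof.
move=> sT; have [/card_leTT[f finj] _] := sT.
have [_ /(_ (range f) (small_image f sT)) sP _] := HK.
apply: small_le sP.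
apply: (@card_le_trans _ _ _ (range (fun X : set T => f @` X))); last first.
  by apply: subset_card_le => _ [X _ <-] _ [x _ <-]; exists x.
apply/card_leE.
have h (X : set T) : range (fun X : set T => f @` X) (f @` X) by exists X.
exists (fun X : [set: set T] => SigSub (mem_set (h (val X)))) => X Y [] XY.
apply: val_inj; apply/seteqP; split=> x Xx.
  have : (f @` val Y) (f x) by rewrite -XY; exists x.
  by move=> [y Yy /finj <-].
have : (f @` val X) (f x) by rewrite XY; exists x.
by move=> [y Yy /finj <-].
Qed.

(** The regularity clause indexes families by subsets of [K]; an embedding of
    the index type into [K] transports it to arbitrary small index types. *)
Lemma small_bigcupK (I : Type) (F : I -> set K) : small K [set: I] ->
  (forall i, small K (F i)) -> small K (\bigcup_i F i).
Proof.
move=> sI sF; have [/card_leTT[g ginj] _] := sI.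
have [_ _ reg] := HK.
pose G k := [set x | exists2 i, g i = k & F i x].
apply: (small_sub (B := \bigcup_(k in range g) G k)).
  by move=> x [i _ Fx]; exists (g i); [exists i|exists i].
apply: reg => [|_ [i _ <-]]; first exact: small_image.
by apply: small_sub (sF i) => x [j /ginj <-].
Qed.

Lemma small_bool : small K [set: bool].
Proof.
apply: small_inj small_nat.
exact: (can_inj (f := nat_of_bool) (g := odd) oddb).
Qed.

(** Regularity, applied to a family of two sets, keeps the union of two small
    subsets of [K] small. *)
Lemma small_common (U V : Type) : small K [set: U] -> small K [set: V] ->
  exists (W : Type) (f : U -> W) (g : V -> W),
    [/\ small K [set: W], injective f & injective g].
Proof.
move=> sU sV.
have [/card_leTT[f finj] _] := sU; have [/card_leTT[g ginj] _] := sV.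
pose W := \bigcup_b (if b then range f else range g).
have Wf u : W (f u) by exists true => //; exists u.
have Wg v : W (g v) by exists false => //; exists v.
exists W, (fun u => SigSub (mem_set (Wf u))), (fun v => SigSub (mem_set (Wg v))).
split; last 2 first.
- by move=> x y [] /finj.
- by move=> x y [] /ginj.
apply/(small_type W); apply: small_bigcupK => [|[]]; first exact: small_bool.
  exact: small_image.
exact: small_image.
Qed.

(** Kuratowski pairs embed the product in a double power set, which is small
    because [K] is a strong limit. *)
Lemma small_prod (U V : Type) :
  small K [set: U] -> small K [set: V] -> small K [set: U * V].
Proof.
move=> sU sV; have [W [f [g [sW finj ginj]]]] := small_common sU sV.
pose pair a b : set (set W) := [set [set a]; [set a; b]].
have pairl a b a' b' : pair a b = pair a' b' -> a = a'.
  move=> ab; have : pair a' b' [set a] by rewrite -ab; left.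
  by move=> [aa|aa]; suff : [set a] a' by []; rewrite aa; try left.
have pairr a b b' : pair a b = pair a b' -> b = a -> b' = a.
  move=> ab ba; have : pair a b [set a; b'] by rewrite ab; right.
  rewrite ba => -[aa|aa]; have : [set a; b'] b' by right.
    by rewrite aa.
  by rewrite aa => -[].
apply: (small_inj (f := fun p => pair (f p.1) (g p.2))); last first.
  exact/small_set/small_set.
move=> [u v] [u' v'] /= uv; have /finj uu := pairl _ _ _ _ uv.
rewrite -uu in uv *; congr (_, _); apply: ginj.
have [|ne] := pselect (g v = f u).
  by move=> e; rewrite (pairr _ _ _ uv e).
have : pair (f u) (g v') [set f u; g v] by rewrite -uv; right.
move=> [aa|aa]; have : [set f u; g v] (g v) by right.
  by rewrite aa.
by rewrite aa => -[].
Qed.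

Lemma small_sum (U V : Type) :
  small K [set: U] -> small K [set: V] -> small K [set: U + V].
Proof.
move=> sU sV; have [W [f [g [sW finj ginj]]]] := small_common sU sV.
apply: (small_inj (f := fun x : U + V =>
  match x with inl u => (true, f u) | inr v => (false, g v) end)).
  by move=> [u|v] [u'|v'] // [] => [/finj|/ginj] ->.
exact: small_prod small_bool sW.
Qed.

Lemma small_option (U : Type) : small K [set: U] -> small K [set: option U].
Proof.
move=> sU; apply: (small_inj (f := fun x : option U =>
  if x is Some u then inl u else inr false)).
  by move=> [u|] [v|] // [->].
exact: small_sum sU small_bool.
Qed.

Lemma small_arrow (U V : Type) :
  small K [set: U] -> small K [set: V] -> small K [set: U -> V].
Proof.
move=> sU sV; apply: (small_inj (f := fun h : U -> V => [set p | p.2 = h p.1])).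
  by move=> h h' /seteqP[hh _]; apply/funext => x; exact: (hh (x, h x)).
exact/small_set/small_prod.
Qed.

Lemma small_bigcup (I U : Type) (F : I -> set U) : small K [set: I] ->
  (forall i, small K (F i)) -> small K (\bigcup_i F i).
Proof.
move=> sI sF.
have fex i : {f : F i -> K | injective f}.
  by apply: cid; have [/card_leTE] := sF i.
pose f i := sval (fex i); have fP i : injective (f i) := svalP (fex i).
pose G := \bigcup_i range (f i).
have /small_type sG : small K G.
  apply: small_bigcupK => // i; apply: small_image; exact: (small_type (F i)).1.
apply: small_le (small_prod sI sG); apply/card_leTE.
have h (x : \bigcup_i F i) : exists p : I * G, exists2 y : F p.1, 
    val y = val x & f p.1 y = val p.2.
  case: x => x xF; have [i _ Fx] := set_mem xF.
  pose y : F i := SigSub (mem_set Fx).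
  have Gy : G (f i y) by exists i => //; exists y.
  by exists (i, SigSub (mem_set Gy)); exists y.
have [c cP] := choice h; exists c => x x' cc; apply: val_inj.
have [y yx fy] := cP x; have := cP x'; rewrite -cc => -[y' yx' fy'].
by rewrite -yx -yx'; congr val; apply: (fP (c x).1); rewrite fy fy'.
Qed.

Lemma small_setU (U : Type) (A B : set U) :
  small K A -> small K B -> small K (A `|` B).
Proof.
move=> sA sB; apply: (small_sub (B := \bigcup_b (if b then A else B))).
  by move=> x [Ax|Bx]; [exists true|exists false].
by apply: small_bigcup => [|[]//]; exact: small_bool.
Qed.

Lemma small_countable (U : Type) (A : set U) : countable A -> small K A.
Proof. by move=> cA; apply: small_le cA small_nat. Qed.

End Small.

(** * Long well-orders *)

Section WellOrder.

Lemma strict_well_order (T : eqType) : exists lt : rel T,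
  [/\ well_founded lt, transitive lt & forall x y, x != y -> lt x y || lt y x].
Proof.
have [r wo] := well_ordering_principle T.
exists (fun x y => r x y && (x != y)); set lt := fun x y => _.
have wc : wo_chain r predT by move=> A _; exact: wo.
have tot : total r by move=> x y; exact: (wo_chainW wc).
have anti : antisymmetric r.
  by move=> x y; apply: (wo_chain_antisymmetric wc).
have minP (P : T -> Prop) : (exists x, P x) -> exists2 x, P x & forall y, P y -> r x y.
  move=> [x Px]; have [|z [[zP zmin] _]] := wo [pred x | `[< P x >]].
    by exists x; rewrite unfold_in /=; apply/asboolP.
  exists z => [|y Py]; first by move: zP; rewrite unfold_in => /asboolP.
  by apply: zmin; rewrite unfold_in /=; apply/asboolP.
have ltP x y : lt x y -> ~ r y x.
  by move=> /andP[xy /eqP ne] yx; apply: ne; apply: anti; rewrite xy.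
have rlt x y : ~ r y x -> lt x y.
  move=> yx; have /orP[xy|//] := tot x y; rewrite /lt xy /=.
  by apply/eqP => e; apply: yx; rewrite -e in xy *.
split.
- move=> x; apply: contrapT => nx.
  have [z nz zmin] := minP (fun x => ~ Acc lt x) (ex_intro _ x nx).
  apply: nz; constructor => y yz; apply: contrapT => /zmin.
  exact: ltP yz.
- move=> y x z xy yz; apply: rlt => zx.
  have [w wxyz wmin] := minP [set x; y; z] (ex_intro _ x (or_introl (or_introl erefl))).
  have rx : r w x by apply: wmin; left; left.
  have ry : r w y by apply: wmin; left; right.
  have rz : r w z by apply: wmin; right.
  case: wxyz => [[]|] e; rewrite e in rx ry rz.
  + have := ltP _ _ yz; apply.
    have e' : x = z by apply: anti; rewrite rz zx.
    by rewrite -e' (proj1 (andP xy)).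
  + exact: ltP xy rx.
  + exact: ltP yz ry.
- move=> x y ne; apply/orP; have /orP[xy|yx] := tot x y; [left|right].
    exact/andP.
  by apply/andP; rewrite eq_sym.
Qed.

Lemma Cantor_not_le (X : Type) : ~ ([set: set X] #<= [set: X]).
Proof.
move=> /card_leTT[f finj].
pose D := [set x | exists2 Y : set X, f Y = x & ~ Y x].
have [DD|nDD] := pselect (D (f D)).
  by have [Y /finj -> ] := DD; apply.
by apply: (nDD); exists D.
Qed.

(** Every small cardinal is exceeded by the cofinality of a small well-order. The
    order is the Hartogs number of [X], the type of functions from [nat] to
    [option S], carved out of a well-order of the power set of [X]. If some
    subset of size at most [S] were unbounded, [I] would be covered by [S]-many
    initial segments that embed in [X], and would embed in [X] itself, because
    [S * option X] does: shift the sequence and store the new entry in front. *)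
Lemma long_well_order (K S : Type) :
  strongly_inaccessible K -> small K [set: S] ->
  exists (I : eqType) (lt : rel I),
    [/\ small K [set: I],
        well_founded lt,
        transitive lt,
        forall i j, i != j -> lt i j || lt j i
      & forall J : set I, J #<= [set: S] -> exists i, forall j, J j -> lt j i].
Proof.
move=> HK sS; pose X := nat -> option S.
have sX : small K [set: X].
  apply: small_arrow => //; first exact: small_nat.
  exact: small_option.
have [lt [wf tr tri]] := strict_well_order {classic set X}.
pose good k := [set j | lt j k] #<= [set: X].
pose I := {k : {classic set X} | good k}.
exists I, (fun i j => lt (val i) (val j)).
have nI : ~ ([set: I] #<= [set: X]).
  have [allgood|/existsNP[k0 bad]] := pselect (forall k, good k).
    move=> IX; apply: (@Cantor_not_le X); apply: card_le_trans IX.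
    apply: (@card_leT_inj _ _ (fun k : set X =>
      exist _ (k : {classic set X}) (allgood k) : I)).
    by move=> x y [].
  (* the least bad [k]: the set of good points is the segment below it *)
  have [k kbad kmin] : exists2 k, ~ good k & forall j, lt j k -> good j.
    elim/(well_founded_ind wf): k0 bad => k IH bad.
    have [all|/existsNP[j /not_implyP[jk jbad]]] :=
      pselect (forall j, lt j k -> good j); first by exists k.
    exact: IH jk jbad.
  move=> IX; apply: kbad; apply: card_le_trans IX.
  apply/card_leTE.
  exists (fun j => exist good (val j) (kmin _ (set_mem (valP j)))) => j j' [].
  exact: val_inj.
split.
- apply: (small_inj (f := fun i : I => (val i : set X))); first exact: val_inj.
  exact: small_set.
- exact: wf_inverse_image wf.
- by move=> j i k; exact: tr.
- by move=> i j ij; apply: tri.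
- move=> J JS; apply: contrapT => /forallNP ub; apply: nI.
  have h (i : I) : exists j : J, ~~ lt (val (val j)) (val i).
    have /existsNP[j /not_implyP[Jj /negP ji]] := ub i.
    by exists (SigSub (mem_set Jj)).
  have [c cP] := choice h.
  have [s sinj] := (card_leTE _ _).1 JS.
  have gex (k : I) : {g : [set j | lt j (val k)] -> X | injective g}.
    by apply: cid; apply/card_leTE; exact: valP k.
  pose g k := sval (gex k); have ginj k : injective (g k) := svalP (gex k).
  (* entry 1 is a flag that separates [None] from a sequence of [None]s *)
  pose enc (s : S) (o : option X) : X := fun n =>
    match n with
    | 0 => Some s
    | 1 => if o is Some _ then Some s else None
    | n.+2 => if o is Some h then h n else None
    end.
  have encP s1 o1 s2 o2 : enc s1 o1 = enc s2 o2 -> s1 = s2 /\ o1 = o2.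
    move=> e; have [es] : Some s1 = Some s2 := congr1 (@^~ 0) e.
    split=> //; have := congr1 (@^~ 1) e.
    case: o1 o2 e => [h1|] [h2|] // e _; congr Some; apply/funext => n.
    exact: (congr1 (@^~ n.+2) e).
  (* [None] codes the top element of the closed segment below [c i] *)
  pose code (i : I) : option X :=
    if pselect (lt (val i) (val (val (c i)))) is left lti
    then Some (g (val (c i)) (SigSub (mem_set
           (lti : [set j | lt j (val (val (c i)))] (val i))))) else None.
  apply: (@card_leT_inj _ _ (fun i => enc (s (c i)) (code i))) => i i' /encP[].
  move=> /sinj cc; have := cP i; have := cP i'; rewrite /code -cc.
  case: pselect => [li|nli]; case: pselect => [li'|nli'] //.
    by move=> _ _ [] /ginj [] /val_inj.
  have atop k : ~ lt (val k) (val (val (c i))) ->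
      ~~ lt (val (val (c i))) (val k) -> k = val (c i).
    move=> nk nk'; apply/eqP; apply: contrapT => /negP ne.
    have /orP[//|] : lt (val k) (val (val (c i))) || lt (val (val (c i))) (val k).
      exact: tri.
    by apply/negP.
  move=> /(atop _ nli') e' /(atop _ nli) e _; rewrite e'; exact: e.
Qed.

End WellOrder.

(** * Renaming, finite support and quantifier elimination of tuples *)

Section Syntax.
Variable L : language.

Fixpoint rename_term (V W : Type) (f : V -> W) (t : term L V) : term L W :=
  match t with
  | Var v => Var (f v)
  | App g args => App g (fun i => rename_term f (args i))
  end.

Fixpoint rename (V : Type) (phi : formula L V) :
    forall W : Type, (V -> W) -> formula L W :=
  match phi with
  | Equal s t => fun W f => Equal (rename_term f s) (rename_term f t)
  | Rel r args => fun W f => Rel r (fun i => rename_term f (args i))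
  | Bot => fun W f => Bot
  | Imp psi chi => fun W f => Imp (rename psi f) (rename chi f)
  | All psi => fun W f => All (rename psi (omap f))
  end.

Definition And (V : Type) (phi psi : formula L V) := Not (Imp phi (Not psi)).
Definition Conj (V : Type) (l : seq (formula L V)) := foldr (@And V) (Not Bot) l.
Definition Ex (V : Type) (phi : formula L (option V)) := Not (All (Not phi)).

End Syntax.

Section Semantics.
Variables (L : language) (M : structure L).
Implicit Types V W X Y : Type.

Lemma eval_rename V W (f : V -> W) (t : term L V) (e : W -> M) :
  eval e (rename_term f t) = eval (e \o f) t.
Proof. by elim: t => //= g args IH; congr func_interp; apply/funext. Qed.

Lemma sat_rename V (phi : formula L V) W (f : V -> W) (e : W -> M) :
  sat (rename phi f) e = sat phi (e \o f).
Proof.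
elim: phi W f e => {V} [V s t|V r args|V|V p IHp q IHq|V p IHp] W f e //=.
- by rewrite !eval_rename.
- by congr rel_interp; apply/funext => i; rewrite eval_rename.
- by rewrite IHp IHq.
- apply: eq_forall => m; rewrite IHp; congr sat.
  by apply/funext; case.
Qed.

Lemma sat_Not V (phi : formula L V) (e : V -> M) : sat (Not phi) e = ~ sat phi e.
Proof. by []. Qed.

Lemma sat_Conj V (l : seq {classic formula L V}) (e : V -> M) :
  sat (Conj l) e <-> forall phi, phi \in l -> sat phi e.
Proof.
elim: l => [|phi l IH] /=; first by split=> // _ [].
split.
  move=> H psi; rewrite inE => /orP[/eqP ->|psil].
    by apply: contrapT => nphi; apply: H => /nphi.
  by apply: contrapT => npsi; apply: H => _ /IH /(_ psi psil).
move=> H; apply; first by apply: H; rewrite inE eqxx.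
by apply/IH => psi psil; apply: H; rewrite inE psil orbT.
Qed.

Lemma sat_Ex V (phi : formula L (option V)) (e : V -> M) :
  sat (Ex phi) e <-> exists m, sat phi (oapp e m).
Proof.
split=> /= [H|[m pm] H]; last exact: H pm.
by apply: contrapT => /forallNP H'; apply: H.
Qed.

Lemma term_support V (t : term L V) : exists s : seq {classic V},
  forall e e' : V -> M, (forall v, v \in s -> e v = e' v) -> eval e t = eval e' t.
Proof.
elim: t => [v|f args IH].
  by exists [:: v] => e e' /(_ v); apply; rewrite inE eqxx.
have [s sP] := choice IH.
exists (flatten [seq s i | i <- enum 'I_(func_arity f)]) => e e' ee /=.
congr func_interp; apply/funext => i; apply: sP => v vs; apply: ee.
by apply/flattenP; exists (s i) => //; apply: map_f; rewrite mem_enum.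
Qed.

Lemma formula_support V (phi : formula L V) : exists s : seq {classic V},
  forall e e' : V -> M, (forall v, v \in s -> e v = e' v) -> sat phi e = sat phi e'.
Proof.
elim: phi => {V} [V t u|V r args|V|V p [s sP] q [s' sP']|V p [s sP]].
- have [s sP] := term_support t; have [s' sP'] := term_support u.
  exists (s ++ s') => e e' ee /=; rewrite (sP e e') ?(sP' e e') // => v vs.
    by apply: ee; rewrite mem_cat vs orbT.
  by apply: ee; rewrite mem_cat vs.
- have [s sP] := choice (fun i => term_support (args i)).
  exists (flatten [seq s i | i <- enum 'I_(rel_arity r)]) => e e' ee /=.
  congr rel_interp; apply/funext => i; apply: sP => v vs; apply: ee.
  by apply/flattenP; exists (s i) => //; apply: map_f; rewrite mem_enum.
- by exists [::].
- exists (s ++ s') => e e' ee /=; rewrite (sP e e') ?(sP' e e') // => v vs.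
    by apply: ee; rewrite mem_cat vs orbT.
  by apply: ee; rewrite mem_cat vs.
- exists (pmap (fun z : {classic option V} => z : option {classic V}) s).
  move=> e e' ee /=; apply: eq_forall => m; apply: sP.
  move=> [v|] //= vs; apply: ee.
  by rewrite mem_pmap; apply/mapP; exists (Some v).
Qed.

(** [g] numbers the elements of [s] from 0; the last index is a dump for the
    variables outside [s], which [v] sends to [None]. *)
Lemma finite_coding V (s : seq {classic V}) :
  exists (n : nat) (g : V -> 'I_n.+1) (v : 'I_n.+1 -> option V),
    forall x, x \in s -> v (g x) = Some x.
Proof.
exists (size s), (fun x => inord (index (x : {classic V}) s)), (fun i => onth s i).
move=> x xs; rewrite inordK ?ltnS ?index_size //.
by rewrite (onthE) (nth_map x) ?index_mem // nth_index.
Qed.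

(** Reduces formulas with infinitely many available variables to finite tuples of
    variables, also when [X] is empty: [m] fills the dump. *)
Lemma finite_left_support X Y (phi : formula L (X + Y)) :
  exists (n : nat) (g : X -> 'I_n.+1) (v : 'I_n.+1 -> option X),
    forall (a : X -> M) (e : Y -> M) (m : M),
      sat phi (join a e) = sat phi (join (fun x => oapp a m (v (g x))) e).
Proof.
have [s sP] := formula_support phi.
have [n [g [v gv]]] := finite_coding (pmap (fun z : {classic X + Y} =>
  if z is inl x then Some (x : {classic X}) else None : option {classic X}) s).
exists n, g, v => a e m; apply: sP => -[x|y] //= xs; rewrite gv //.
by rewrite mem_pmap; apply/mapP; exists (inl x).
Qed.

Definition sum_map X X' Y Y' (f : X -> X') (g : Y -> Y') (z : X + Y) : X' + Y' :=
  match z with inl x => inl (f x) | inr y => inr (g y) end.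

Lemma join_sum_map X X' Y Y' (f : X -> X') (g : Y -> Y') (a : X' -> M) (e : Y' -> M) :
  join a e \o sum_map f g = join (a \o f) (e \o g).
Proof. by apply/funext; case. Qed.

Lemma exists_elim_fin n Y (phi : formula L ('I_n + Y)) :
  exists psi : formula L Y, forall e : Y -> M,
    sat psi e <-> exists c : 'I_n -> M, sat phi (join c e).
Proof.
elim: n phi => [|n IH] phi.
  pose absurd (T : Type) (i : 'I_0) : T := False_rect T (notF (ltn_ord i)).
  exists (rename phi (fun z => match z with inl i => absurd Y i | inr y => y end)) => e.
  rewrite sat_rename; split=> [H|[c]].
    exists (absurd M).
    by move: H; congr sat; apply/funext; case=> // -[].
  by congr sat; apply/funext; case=> // -[].
pose h (z : 'I_n.+1 + Y) : option ('I_n + Y) :=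
  match z with
  | inl i => omap inl (unlift ord0 i)
  | inr y => Some (inr y)
  end.
have [psi psiP] := IH (Ex (rename phi h)).
exists psi => e; rewrite psiP; split.
  move=> [c /sat_Ex[m]]; rewrite sat_rename => H.
  exists (fun i => oapp c m (unlift ord0 i)).
  move: H; congr sat; apply/funext; case=> //= i.
  by case: unliftP.
move=> [c H]; exists (fun i => c (lift ord0 i)); apply/sat_Ex.
exists (c ord0); rewrite sat_rename.
move: H; congr sat; apply/funext; case=> //= i.
by case: unliftP => [j|] ->.
Qed.

(** A formula uses finitely many variables of [X], so quantifying existentially
    over the whole, possibly infinite, tuple is first-order. *)
Lemma exists_elim X Y (phi : formula L (X + Y)) :
  exists psi : formula L Y, forall e : Y -> M,
    sat psi e <-> exists a : X -> M, sat phi (join a e).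
Proof.
have [n [g [v gv]]] := finite_left_support phi.
have [psi psiP] := exists_elim_fin (rename phi (sum_map g id)).
exists psi => e; rewrite psiP; split=> [[c]|[a]].
  by rewrite sat_rename join_sum_map; exists (c \o g).
have [m] := carrier_inhabited M.
rewrite (gv _ _ m) => H; exists (fun i => oapp a m (v i)).
by rewrite sat_rename join_sum_map.
Qed.

Lemma sat_automorphism (s : M -> M) V (phi : formula L V) (e : V -> M) :
  automorphism s -> sat phi (s \o e) = sat phi e.
Proof.
move=> [sbij sfun srel].
have ev W (t : term L W) (d : W -> M) : eval (s \o d) t = s (eval d t).
  elim: t => //= f args IH; rewrite sfun; congr func_interp; exact/funext.
elim: phi e => {V} [V t u|V r args|V|V p IHp q IHq|V p IHp] e //=.
- by rewrite !ev; apply/propext; split=> [|->] // /(bij_inj sbij).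
- rewrite [RHS](propext (srel _ _)); congr rel_interp; apply/funext => i; exact: ev.
- by rewrite IHp IHq.
- have [s' sK s'K] := sbij.
  have oe m : oapp (s \o e) (s m) = s \o oapp e m by apply/funext; case.
  apply/propext; split=> H m; first by rewrite -IHp -oe.
  by rewrite -(s'K m) oe IHp.
Qed.

Lemma automorphism_id : automorphism (@id M).
Proof. by split=> //; exists id. Qed.

Lemma automorphism_inv (s : M -> M) : automorphism s ->
  exists t : M -> M, [/\ automorphism t, cancel s t & cancel t s].
Proof.
move=> [[t sK tK] sf sr]; exists t; split=> //; split.
- by exists s.
- move=> f a; apply: (can_inj sK); rewrite tK sf; congr func_interp.
  by apply/funext => i /=; rewrite tK.
- move=> r a; rewrite [X in _ <-> X]sr.
  suff -> : s \o (t \o a) = a by [].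
  by apply/funext => i /=; rewrite tK.
Qed.

End Semantics.

(** * Saturation for small tuples of variables *)

Section Saturation.
Variables (L : language) (K : Type) (M : structure L).
Hypothesis HK : strongly_inaccessible K.
Hypothesis Hsat : saturated K M.
Variable V : Type.
Hypothesis sV : small K [set: V].
Variable G : set (formula L V).

(** Parameters are variables in [P] whose value is already prescribed by [e]; this
    puts parameters and unknowns on the same footing in the induction. *)
Definition finitely_completable (P : set V) (e : V -> M) : Prop :=
  forall l : seq {classic formula L V}, (forall phi, phi \in l -> G phi) ->
    exists2 e' : V -> M, (forall v, P v -> e' v = e v) &
                         forall phi, phi \in l -> sat phi e'.

(** The condition that a value of [x] puts on the remaining unknowns is a formula
    in [x] alone over the values already prescribed. *)
Lemma definable_extension (P : set V) (e : V -> M) (x : V)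
    (l : seq {classic formula L V}) :
  exists psi : formula L (unit + (e @` P)), forall m : M,
    sat psi (join (fun _ : unit => m) (fun d : e @` P => val d)) <->
    exists e' : V -> M, [/\ forall v, P v -> v <> x -> e' v = e v, e' x = m
                         & forall phi, phi \in l -> sat phi e'].
Proof.
pose h (v : V) : V + (unit + (e @` P)) :=
  if pselect (v = x) then inr (inl tt) else
  if pselect (P v) is left Pv then inr (inr (SigSub (mem_set (imageP e Pv))))
  else inl v.
have [psi psiP] := exists_elim M (rename (Conj l) h).
exists psi => m; rewrite psiP; split.
  move=> [a]; rewrite sat_rename => /sat_Conj H.
  eexists; split; last exact: H.
    by move=> v Pv vx /=; rewrite /h; case: pselect => //; case: pselect.
  by rewrite /= /h; case: pselect.
move=> [e' [eP ex H]]; exists e'; rewrite sat_rename.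
suff -> : join e' (join (fun=> m) (fun d : e @` P => val d)) \o h = e'.
  exact/sat_Conj.
apply/funext => v /=; rewrite /h; case: pselect => [vx /=|vx]; first by rewrite vx ex.
by case: pselect => //= Pv; rewrite eP.
Qed.

Lemma finitely_completable_step (P : set V) (e : V -> M) (x : V) :
  ~ P x -> finitely_completable P e ->
  exists m, finitely_completable (P `|` [set x])
              (fun v => if pselect (v = x) then m else e v).
Proof.
move=> nPx fc.
pose p : partial_type unit (e @` P) := [set psi |
  exists2 l : seq {classic formula L V}, (forall phi, phi \in l -> G phi) &
  forall m : M,
    sat psi (join (fun _ : unit => m) (fun d : e @` P => val d)) <->
    exists e' : V -> M, [/\ forall v, P v -> v <> x -> e' v = e v, e' x = m
                         & forall phi, phi \in l -> sat phi e']].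
have [|q qp fq|a pa] := @Hsat (e @` P) p.
- by apply: small_image; apply: small_sub sV.
- have [s qs] : exists s : seq {classic formula L (unit + (e @` P))}, q = [set` s].
    exact/finite_seqP.
  suff [l lG lP] : exists2 l : seq {classic formula L V},
      (forall phi, phi \in l -> G phi) &
      forall m e', [/\ forall v, P v -> v <> x -> e' v = e v, e' x = m
                         & forall phi, phi \in l -> sat phi e'] ->
        forall psi, psi \in s ->
        sat psi (join (fun _ : unit => m) (fun d : e @` P => val d)).
    have [e' eP eG] := fc l lG; exists (fun=> e' x) => psi; rewrite qs => psis.
    by apply: (lP _ e' _ _ psis); split=> // v Pv _; exact: eP.
  have : forall psi, psi \in s -> p psi by move=> psi ps; apply: qp; rewrite qs.
  elim: s {qs} => [|psi s IH] sp; first by exists [::].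
  have [|l lG lP] := IH; first by move=> ? ps; apply: sp; rewrite inE ps orbT.
  have [|l' lG' lP'] := sp psi; first by rewrite inE eqxx.
  exists (l ++ l') => [phi|m e' [eP ex el] psi'].
    by rewrite mem_cat => /orP[/lG|/lG'].
  rewrite inE => /orP[/eqP ->|ps].
    by apply/lP'; exists e'; split=> // phi pl; apply: el; rewrite mem_cat pl orbT.
  by apply: (lP m e' _ _ ps); split=> // phi pl; apply: el; rewrite mem_cat pl.
exists (a tt) => l lG.
have [psi psiP] := definable_extension P e x l.
have psip : p psi by exists l.
have /= := pa _ psip.
have -> : a = (fun=> a tt) by apply/funext; case.
move=> /psiP[e' [eP ex el]]; exists e' => // v.
move=> [Pv|->]; last by case: pselect.
by case: pselect => [vx /=|vx]; [rewrite vx|exact: eP].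
Qed.

(** Saturation in one variable extends to small tuples: a partial solution that
    is maximal for extension (Zorn) is defined everywhere, since one more variable
    can always be treated. At limit stages nothing is lost, because a finite set
    of formulas only sees finitely many variables. *)
Lemma saturated_tuple (P : set V) (e : V -> M) : finitely_completable P e ->
  exists2 e' : V -> M, (forall v, P v -> e' v = e v) & forall phi, G phi -> sat phi e'.
Proof.
move=> fc.
pose ext (p q : set V * (V -> M)) := p.1 `<=` q.1 /\ forall v, p.1 v -> q.2 v = p.2 v.
have extxx p : ext p p by split.
have ext_trans p q r : ext p q -> ext q r -> ext p r.
  move=> [pq epq] [qr eqr]; split; first exact: subset_trans qr.
  by move=> v pv; rewrite eqr ?epq //; exact: pq.
pose T := {p : set V * (V -> M) | ext (P, e) p /\ finitely_completable p.1 p.2}.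
pose t0 : T := exist _ (P, e) (conj (extxx (P, e)) fc).
pose R (s t : T) := `[< ext (sval s) (sval t) >].
have [t tmax] : exists t, premaximal R t.
  apply: (ZL_preorder t0).
  - by move=> t; apply/asboolP; exact: extxx.
  - by move=> r s t /asboolP rs /asboolP st; apply/asboolP; exact: ext_trans st.
  move=> C Ctot; have [[t Ct]|/forallNP C0] := pselect (exists t, C t); last first.
    by exists t0 => s /C0.
  pose Q := \bigcup_(s in C) (sval s).1.
  have /choice[d dP] v : exists m, forall s, C s -> (sval s).1 v -> m = (sval s).2 v.
    have [[s [Cs sv]]|/forallNP H] := pselect (exists s, C s /\ (sval s).1 v).
      exists ((sval s).2 v) => s' Cs' sv'.
      have [/asboolP[_ ss]|/asboolP[_ ss]] := Ctot _ _ Cs Cs'.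
        by rewrite ss.
      by rewrite ss.
    by exists (e v) => s Cs sv; have := H s; case.
  have exts s : C s -> ext (sval s) (Q, d).
    by move=> Cs; split=> [v sv|v sv]; [exists s|exact: dP].
  have Qfc : finitely_completable Q d.
    move=> l lG; have [s sP] := formula_support M (Conj l : formula L V).
    have [u Cu uP] : exists2 u, C u & forall v, v \in s -> Q v -> (sval u).1 v.
      elim: s {sP} => [|v s [u Cu uP]]; first by exists t.
      have [[u' Cu' u'v]|nQv] := pselect (Q v); last first.
        by exists u => // v'; rewrite inE => /orP[/eqP ->|/uP].
      have [/asboolP[uu _]|/asboolP[uu _]] := Ctot _ _ Cu Cu'.
        exists u' => // v'; rewrite inE => /orP[/eqP -> //|/uP H /H]; exact: uu.
      by exists u => // v'; rewrite inE => /orP[/eqP -> _|/uP //]; exact: uu.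
    have [_ ufc] := svalP u; have [e' eu /sat_Conj el] := ufc l lG.
    exists (fun v => if v \in s then e' v else d v).
      move=> v Qv; case: ifP => // vs; rewrite eu ?(dP v u) //; exact: uP.
    by apply/sat_Conj; rewrite (sP _ e') // => v ->.
  exists (exist _ (Q, d) (conj (ext_trans _ _ _ (proj1 (svalP t)) (exts t Ct)) Qfc)).
  by move=> s Cs; apply/asboolP; exact: exts.
case: t tmax => -[Q d] [ed Qfc] /= tmax.
have Qall v : Q v.
  apply: contrapT => nQv; have [m mfc] := finitely_completable_step nQv Qfc.
  set d' := (fun _ => _) in mfc.
  have dd : ext (Q, d) (Q `|` [set v], d').
    split=> w Qw; first by left.
    by rewrite /d' /=; case: pselect => // wv; rewrite -wv in nQv.
  pose t' : T := exist _ (Q `|` [set v], d') (conj (ext_trans _ _ _ ed dd) mfc).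
  have /asboolP[/= QQ _] : R t' (exist _ (Q, d) (conj ed Qfc)).
    by apply: tmax; exact/asboolP.
  by apply: nQv; apply: QQ; right.
exists d => [v|phi Gphi]; first exact: (proj2 ed).
have [|e' ee' el] := Qfc [:: phi]; first by move=> psi; rewrite inE => /eqP ->.
have <- : e' = d by apply/funext => v; exact/ee'/Qall.
by apply: el; rewrite inE.
Qed.

End Saturation.

(** * Tuples with the same type are conjugate *)

Section Homogeneity.
Variables (L : language) (K : Type) (M : structure L).
Hypothesis Hhom : strongly_homogeneous K M.

Lemma conjugate_tuples (X : Type) (a a' : X -> M) : small K [set: X] ->
  (forall phi : formula L X, sat phi a -> sat phi a') ->
  exists2 s : M -> M, automorphism s & s \o a = a'.
Proof.
move=> sX aa.
have aaE phi : sat phi a <-> sat phi a'.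
  split; first exact: aa.
  by move=> a'phi; apply: contrapT => nphi; exact: (aa (Not phi) nphi).
pose f m := if pselect (exists x, a x = m) is left h then a' (projT1 (cid h)) else m.
have fa x : f (a x) = a' x.
  rewrite /f; case: pselect => [h|[]]; last by exists x.
  by case: cid => y /= ayx; exact: (aa (Equal (Var y) (Var x))).
have [||s sa sf] := @Hhom (range a) f; first exact: small_image sX.
  move=> n phi c cP.
  have /choice[x xP] i : exists x, a x = c i by have [x _ <-] := cP i; exists x.
  have -> : c = a \o x by apply/funext => i; rewrite /= xP.
  have -> : f \o (a \o x) = a' \o x by apply/funext => i /=; exact: fa.
  by have := aaE (rename phi x); rewrite !sat_rename.
by exists s => //; apply/funext => x /=; rewrite sf ?fa //; exists x.
Qed.

End Homogeneity.

(** * Small elementary subsets *)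

Section CountFormulas.
Variables (L : language) (ef : func L -> nat) (er : rel_symb L -> nat).
Hypotheses (efinj : injective ef) (erinj : injective er).

Fixpoint term_code (V : Type) (ev : V -> nat) (t : term L V) : GenTree.tree nat :=
  match t with
  | Var v => GenTree.Leaf (ev v)
  | App f args =>
      GenTree.Node (ef f) [seq term_code ev (args i) | i <- enum 'I_(func_arity f)]
  end.

(** The quantified variable takes code 0 and the free variables are shifted, so
    that [ev] stays injective under binders. *)
Fixpoint formula_code (V : Type) (phi : formula L V) : (V -> nat) -> GenTree.tree nat :=
  match phi with
  | Equal s t => fun ev => GenTree.Node 0 [:: term_code ev s; term_code ev t]
  | Rel r args => fun ev => GenTree.Node 1 (GenTree.Leaf (er r) ::
       [seq term_code ev (args i) | i <- enum 'I_(rel_arity r)])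
  | Bot => fun ev => GenTree.Node 2 [::]
  | Imp p q => fun ev => GenTree.Node 3 [:: formula_code p ev; formula_code q ev]
  | All p => fun ev => GenTree.Node 4
      [:: formula_code p (fun z => if z is Some v then (ev v).+1 else 0)]
  end.

Lemma map_enum_inj n (T : Type) (f g : 'I_n -> T) :
  [seq f i | i <- enum 'I_n] = [seq g i | i <- enum 'I_n] -> f =1 g.
Proof.
move=> fg i; have si : i < size (enum 'I_n) by rewrite size_enum_ord.
have := congr1 (fun s => nth (f i) s i) fg.
by rewrite /= !(nth_map i _ _ si) nth_ord_enum.
Qed.

Lemma term_code_inj V (ev : V -> nat) : injective ev -> injective (term_code ev).
Proof.
move=> evi; elim=> [v|f a IH] [v'|f' a'] //= [].
  by move=> /evi ->.
move=> /efinj ff; case: f' / ff a' => a' /map_enum_inj aa.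
by congr App; apply/funext => i; exact: IH.
Qed.

Lemma formula_code_inj V (phi psi : formula L V) (ev : V -> nat) :
  injective ev -> formula_code phi ev = formula_code psi ev -> phi = psi.
Proof.
elim: phi psi ev => {V} [V s t|V r a|V|V p IHp q IHq|V p IHp] psi ev evi.
- by case: psi => //= s' t' [] /(term_code_inj evi) -> /(term_code_inj evi) ->.
- case: psi => //= r' a' [] /erinj rr; case: r' / rr a' => a' /map_enum_inj aa.
  by congr Rel; apply/funext => i; exact/(term_code_inj evi)/aa.
- by case: psi.
- by case: psi => //= p' q' [] /(IHp _ _ evi) -> /(IHq _ _ evi) ->.
- case: psi => //= p' [] /IHp -> //.
  by move=> [x|] [y|] //= [] /evi ->.
Qed.

End CountFormulas.

Lemma countable_formulas (L : language) : countable_language L ->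
  countable [set: formula L nat].
Proof.
move=> [/card_leTT[ef efi] /card_leTT[er eri]].
apply: (@card_leT_inj _ _ (fun phi => pickle (formula_code ef er phi id))).
move=> p q /(pcan_inj pickleK) pq.
by apply: (formula_code_inj efi eri) pq.
Qed.

Section ElementarySubstructure.
Variables (L : language) (K : Type) (M : structure L).
Hypothesis HK : strongly_inaccessible K.

(** The Tarski-Vaught criterion for [N] to be the universe of an elementary
    substructure. *)
Definition elementary_subset (N : set M) : Prop :=
  forall phi : formula L (option N),
    (exists m : M, sat phi (oapp (fun d : N => val d) m)) ->
    exists2 m : M, N m & sat phi (oapp (fun d : N => val d) m).

(** Witnesses are added for formulas in countably many variables evaluated at
    arbitrary sequences of the current set, [omega] times. The union need not be
    closed under sequences, but a formula sees a finite part of a sequence, and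
    that part lies in some finite stage. *)
Lemma downward_Loewenheim_Skolem (C : set M) : countable_language L -> small K C ->
  exists N : set M, [/\ C `<=` N, small K N & elementary_subset N].
Proof.
move=> HL sC; have [m0] := carrier_inhabited M.
pose sc m (e : nat -> M) n := if n is k.+1 then e k else m.
have /choice[w wP] (p : formula L nat * (nat -> M)) : exists m : M,
    (exists m', sat p.1 (sc m' p.2)) -> sat p.1 (sc m p.2).
  have [[m mP]|nex] := pselect (exists m', sat p.1 (sc m' p.2)); first by exists m.
  by exists m0.
pose next (D : set M) := D `|`
  range (fun p : formula L nat * (nat -> D) => w (p.1, fun n => val (p.2 n))).
pose Nk k := iter k next (C `|` [set m0]).
have sNk k : small K (Nk k).
  elim: k => [|k IH].
    apply: small_setU => //; apply: small_countable => //; exact: countable1.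
  apply: small_setU => //; apply: small_image; apply: small_prod => //.
    exact/small_countable/countable_formulas.
  apply: small_arrow => //; first exact: small_nat.
  exact/(small_type K (Nk k)).1.
have Nkmono k k' : k <= k' -> Nk k `<=` Nk k'.
  by move=> /subnK <-; elim: (k' - k) => //= n IH x /IH; left.
exists (\bigcup_k Nk k); split.
- by move=> x Cx; exists 0 => //; left.
- by apply: small_bigcup => //; exact: small_nat.
set N := \bigcup_k Nk k => phi ex.
pose phi1 : formula L (N + unit) :=
  rename phi (fun z => if z is Some x then inl x else inr tt).
have phi1P m : sat phi (oapp (fun d : N => val d) m) =
    sat phi1 (join (fun d : N => val d) (fun=> m)).
  by rewrite sat_rename; congr sat; apply/funext; case.
have [n [g [v gv]]] := finite_left_support M phi1.
pose e k := oapp (fun d : N => val d) m0 (v (inord k)).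
pose phi2 : formula L nat :=
  rename phi1 (fun z => match z with inl x => (nat_of_ord (g x)).+1 | inr _ => 0 end).
have phi2P m : sat phi (oapp (fun d : N => val d) m) = sat phi2 (sc m e).
  rewrite phi1P (gv _ _ m0) [RHS]sat_rename; congr sat; apply/funext; case=> //= x.
  by rewrite /e inord_val.
have /choice[r rP] (i : 'I_n.+1) : exists k, Nk k (oapp (fun d : N => val d) m0 (v i)).
  case: (v i) => [d|] /=; last by exists 0; right.
  by have [k _ kd] := set_mem (valP d); exists k.
have eN k : Nk (\max_i r i) (e k).
  apply: Nkmono (rP (inord k)); exact: leq_bigmax.
pose e' k : Nk (\max_i r i) := SigSub (mem_set (eN k)).
exists (w (phi2, e)).
  by exists (\max_i r i).+1 => //; right; exists (phi2, e').
rewrite phi2P; apply: (wP (phi2, e)) => /=.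
by have [m mP] := ex; exists m; rewrite -phi2P.
Qed.

Definition finitely_satisfiable_in (X : Type) (a : X -> M) (D N : set M) : Prop :=
  forall phi : formula L (X + D), sat phi (join a (fun d : D => val d)) ->
    exists2 f : X -> M, (forall x, N (f x)) & sat phi (join f (fun d : D => val d)).

(** The Tarski-Vaught criterion deals with one variable; treating the variables
    one after the other moves a finite tuple into [N], and only finitely many
    entries of [a] matter to a formula. *)
Lemma elementary_finitely_satisfiable (N : set M) (X : Type) (a : X -> M) :
  N !=set0 -> elementary_subset N -> finitely_satisfiable_in a N N.
Proof.
move=> [n0 Nn0] NM.
suff fin n (phi : formula L ('I_n + N)) (c : 'I_n -> M) :
    sat phi (join c (fun d : N => val d)) ->
    exists2 f : 'I_n -> M, (forall x, N (f x)) & sat phi (join f (fun d : N => val d)).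
  move=> phi; have [n [g [v gv]]] := finite_left_support M phi.
  rewrite (gv _ _ n0) => H.
  have [|f fN fP] := fin n.+1 (rename phi (sum_map g id)) (fun i => oapp a n0 (v i)).
    by rewrite sat_rename join_sum_map.
  by exists (f \o g) => [x|]; [exact: fN|]; move: fP; rewrite sat_rename join_sum_map.
elim: n phi c => [|n IH] phi c; first by exists c => // -[].
move=> H.
pose h (z : 'I_n.+1 + N) : 'I_n + option N :=
  match z with
  | inl i => if unlift ord0 i is Some j then inl j else inr None
  | inr d => inr (Some d)
  end.
have hP (b : 'I_n -> M) m : join b (oapp (fun d : N => val d) m) \o h =
    join (fun i => oapp b m (unlift ord0 i)) (fun d : N => val d).
  by apply/funext; case=> //= i; case: unliftP.
have cE : (fun i => oapp (fun j => c (lift ord0 j)) (c ord0) (unlift ord0 i)) = c.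
  by apply/funext => i; case: unliftP => [j|] ->.
have [psi psiP] := exists_elim M (rename phi h).
have [|m Nm] := NM psi.
  exists (c ord0); apply/psiP; exists (fun j => c (lift ord0 j)).
  by rewrite sat_rename hP cE.
move=> /psiP[b]; rewrite sat_rename hP => bP.
pose k (z : 'I_n.+1 + N) : 'I_n + N :=
  match z with
  | inl i => if unlift ord0 i is Some j then inl j else inr (SigSub (mem_set Nm))
  | inr d => inr d
  end.
have kP (f : 'I_n -> M) : join f (fun d : N => val d) \o k =
    join (fun i => oapp f m (unlift ord0 i)) (fun d : N => val d).
  by apply/funext; case=> //= i; case: unliftP.
have [|f fN] := IH (rename phi k) b; first by rewrite sat_rename kP.
rewrite sat_rename kP => fP.
exists (fun i => oapp f m (unlift ord0 i)) => // i.
by case: unliftP => [j _|_] /=.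
Qed.

(** Finite satisfiability says that the traces on tuples of [N] of the formulas of
    [tp (a / D)] generate a proper filter; [U] is an ultrafilter above it. *)
Lemma coheir_ultrafilter (X : Type) (a : X -> M) (D N : set M) :
  finitely_satisfiable_in a D N ->
  exists U : set_system (X -> M),
    [/\ UltraFilter U, U [set f | forall x, N (f x)]
      & forall phi : formula L (X + D), sat phi (join a (fun d : D => val d)) ->
          U [set f | sat phi (join f (fun d : D => val d))]].
Proof.
move=> fs.
pose F : set_system (X -> M) := filter_from
  [set phi : formula L (X + D) | sat phi (join a (fun d : D => val d))]
  (fun phi => [set f | (forall x, N (f x)) /\ sat phi (join f (fun d : D => val d))]).
have FF : ProperFilter F.
  apply: filter_from_proper; last by move=> phi /fs[f fN fP]; exists f.
  apply: filter_from_filter; first by exists (Not Bot) => /=.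
  move=> p q /= pa qa; exists (Conj [:: p; q]).
    by apply/sat_Conj => r; rewrite !inE => /orP[] /eqP ->.
  move=> f [fN /sat_Conj H]; split; split=> //; apply: H; rewrite !inE eqxx //.
  by rewrite orbT.
have [U [UU FU]] := ultraFilterLemma FF.
exists U; split=> //.
  by apply: FU; exists (Not Bot) => //= f [].
by move=> phi pa; apply: FU; exists phi => // f [].
Qed.

End ElementarySubstructure.

(** * Independence along long sequences and coheirs *)

Section Independence.
Variables (L : language) (K : Type) (M : structure L).
Hypothesis HK : strongly_inaccessible K.
Hypothesis Hsat : saturated K M.
Hypothesis Hhom : strongly_homogeneous K M.
Variable R : ternary_relation M.
Hypothesis HR : adler_independence K R.
Implicit Types A B C D N E : set M.

Definition aut_over C (s : M -> M) : Prop := automorphism s /\ forall x, C x -> s x = x.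

Lemma aut_over_inv C s : aut_over C s ->
  exists t, [/\ aut_over C t, cancel s t & cancel t s].
Proof.
move=> [sa sC]; have [t [ta sK tK]] := automorphism_inv sa.
by exists t; split=> //; split=> // x Cx; rewrite -{1}(sC x Cx) sK.
Qed.

Lemma aut_over_image C s : aut_over C s -> s @` C = C.
Proof.
move=> [_ sC]; apply/seteqP; split=> [_ [x Cx <-]|x Cx]; first by rewrite sC.
by exists x => //; exact: sC.
Qed.

Lemma image_cancel A (s t : M -> M) : cancel s t -> t @` (s @` A) = A.
Proof.
move=> sK; apply/seteqP; split=> [_ [_ [x Ax <-] <-]|x Ax]; first by rewrite sK.
by exists (s x); [exists x|exact: sK].
Qed.

Lemma aut_over_indep A B C s : small K A -> small K B -> small K C ->
  aut_over C s -> R A C B <-> R (s @` A) C (s @` B).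
Proof.
move=> sA sB sC [sa sC']; rewrite (air_invariant HR sa) //.
by rewrite (aut_over_image (conj sa sC')).
Qed.

Lemma right_subset A B C D : small K A -> small K C -> small K D ->
  B `<=` D -> R A C D -> R A C B.
Proof.
move=> sA sC sD BD H; apply: (air_right_monotonicity HR (D := D)) => //.
  exact: small_sub BD sD.
by rewrite (setUidr BD).
Qed.

Lemma left_subset A B C D : small K D -> small K B -> small K C ->
  A `<=` D -> R D C B -> R A C B.
Proof.
move=> sD sB sC AD H; apply: (air_left_monotonicity HR (D := D)) => //.
  exact: small_sub AD sD.
by rewrite (setUidr AD).
Qed.

Lemma indep_base A C : small K A -> small K C -> R A C C.
Proof.
move=> sA sC; have [S _ /(_ C sC)[C0 [C0C _ RC0]]] := air_local_character HR sA.
apply: (air_right_base_monotonicity HR (C := C0)) => //.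
exact: small_sub C0C sC.
Qed.

(** Local character and base monotonicity give [R A C C]; extension does the rest. *)
Lemma indep_existence A C D : small K A -> small K C -> small K D ->
  exists2 s, aut_over C s & R (s @` A) C D.
Proof.
move=> sA sC sD.
have [||A' [s [sa sC' sA'] RA']] :=
    air_extension HR (B := C) (D := C `|` D) sA sC sC _ _ (indep_base sA sC).
- exact: small_setU.
- exact: subsetUl.
have [|t [ta sK tK]] := @aut_over_inv C s; first by split=> // x Cx; apply: sC'; left.
exists t => //; rewrite -sA' image_cancel //.
apply: right_subset RA' => //.
- by rewrite -(image_cancel A' sK) sA'; exact: small_image.
- exact: small_setU.
Qed.

(** The cardinal given by local character for [A] also works for [A'], a conjugate
    of [A], by invariance; so it is known before the sequence is chosen, and the
    sequence can be taken of larger cofinality. *)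
Lemma indep_of_long_sequence A B C : small K A -> small K B -> small K C ->
  (forall (I : eqType) (lt : rel I), small K [set: I] -> well_founded lt ->
     transitive lt -> (forall i j, i != j -> lt i j || lt j i) ->
     exists (N A' : set M) (s : I -> M -> M),
       [/\ small K N, C `<=` N, forall i, aut_over C (s i),
           forall i, s i @` A = A' &
           forall i, R (N `|` \bigcup_(j in [set j | lt j i]) (s j @` B))
                       C (s i @` B)]) ->
  R A C B.
Proof.
move=> sA sB sC H.
have [S sS locA] := air_local_character HR sA.
have sS' := (small_type K S).1 sS.
have [I [lt [sI wf tr tri bnd]]] := long_well_order HK sS'.
have [N [A' [s [sN CN sa sA' Rs]]]] := H I lt sI wf tr tri.
have [|i0 _] := bnd set0; first exact: card_ge0.
have sAA' : small K A' by rewrite -(sA' i0); exact: small_image.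
have sD i : small K (s i @` B) by exact: small_image.
pose E := N `|` \bigcup_i (s i @` B).
have sE : small K E by apply: small_setU => //; exact: small_bigcup.
have [B0 [B0E cB0 RB0]] : exists B0, [/\ B0 `<=` E, B0 #<= [set: S] & R A' B0 E].
  have [t [[ta tC] sK tK]] := aut_over_inv (sa i0).
  have [B0 [B0t [cB0 _] RB0]] := locA (t @` E) (small_image t sE).
  exists (s i0 @` B0); split.
  - by move=> _ [x /B0t[y Ey <-] <-]; rewrite tK.
  - apply: card_le_trans (card_image_le _ _) _; apply: card_le_trans cB0 _.
    by have := card_setT S; rewrite card_eq_le => /andP[].
  - have [sa0 _] := sa i0.
    move: RB0; rewrite (air_invariant HR sa0) //; last first.
    + exact: small_sub B0t (small_image t sE).
    + exact: small_image.
    by rewrite (sA' i0) (image_cancel _ tK).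
have /choice[c cP] (x : B0) : exists i, N (val x) \/ (s i @` B) (val x).
  have [Nx|[i _ Bx]] := B0E _ (set_mem (valP x)); first by exists i0; left.
  by exists i; right.
have [|b bP] := bnd (range c).
  apply: card_le_trans (card_image_le _ _) _; apply: card_le_trans cB0.
  by have := card_setT B0; rewrite card_eq_le => /andP[].
set P := N `|` \bigcup_(j in [set j | lt j b]) (s j @` B).
have RP : R P C (s b @` B) by exact: Rs.
have PE : P `<=` E by move=> x [Nx|[j _ Bx]]; [left|right; exists j].
have sP := small_sub PE sE.
have B0P : B0 `<=` P.
  move=> x B0x; pose x' : B0 := SigSub (mem_set B0x).
  have [Nx|Bx] := cP x'; first by left.
  by right; exists (c x') => //; apply: bP; exists x'.
have RA : R A' P (s b @` B).
  apply: (right_subset sAA' sP sE); first by move=> x Bx; right; exists b.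
  apply: (air_right_base_monotonicity HR (C := B0)) => //.
  exact: small_sub B0P sP.
have CP : C `<=` P by move=> x Cx; left; exact: CN.
have RAP : R (A' `|` P) C (s b @` B).
  apply: (air_left_transitivity HR (B := P)) => //.
  - exact: small_setU.
  - exact: (air_left_normality HR).
rewrite (aut_over_indep sA sB sC (sa b)) sA'.
by apply: left_subset RAP => //; exact: small_setU.
Qed.

(** The extension axiom moves the left-hand side: it provides an automorphism
    taking the union of the earlier terms to a set independent from [D]. The
    inverse automorphism moves [D] instead and leaves the earlier terms in place. *)
Lemma independent_sequence D C (I : Type) (lt : I -> I -> Prop) :
  small K D -> small K C -> small K [set: I] -> well_founded lt ->
  exists s : I -> M -> M, (forall i, aut_over C (s i)) /\
    forall i, R (\bigcup_(j in [set j | lt j i]) (s j @` D)) C (s i @` D).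
Proof.
move=> sD sC sI wf.
have /choice[st stP] (E : set M) :
    exists s, aut_over C s /\ (small K E -> R E C (s @` D)).
  have [sE|nE] := pselect (small K E); last first.
    by exists id; split=> //; split=> //; exact: automorphism_id.
  have [s sa Rs] := indep_existence sE sC sD.
  have [t [ta sK tK]] := aut_over_inv sa; exists t; split=> // _.
  move: Rs; rewrite (aut_over_indep _ _ _ ta) // ?image_cancel //.
  exact: small_image.
(* [st E] moves [D] to a position from which [E] is independent *)
pose F (i : I) (rec : forall j, lt j i -> M -> M) :=
  st [set x | exists j (h : lt j i), (rec j h @` D) x].
pose s := Fix wf (fun _ => M -> M) F.
have sE i : s i = st (\bigcup_(j in [set j | lt j i]) (s j @` D)).
  rewrite /s Fix_eq.
    rewrite {1}/F; congr st; apply/seteqP; split=> x.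
      by move=> [j [h jx]]; exists j.
    by move=> [j h jx]; exists j, h.
  move=> j f g fg; congr F; apply: functional_extensionality_dep => k.
  by apply: functional_extensionality_dep => h.
exists s; split=> i; rewrite sE; first exact: (proj1 (stP _)).
apply: (proj2 (stP _)); apply: (@small_sub _ _ _ (\bigcup_j (s j @` D))).
  by move=> x [j _ jx]; exists j.
by apply: small_bigcup => // j; exact: small_image.
Qed.

(** [a'] realises the average of [U] over all the terms of an independent
    sequence of conjugates of [D]. Since [U] lives on tuples of [N], which the
    conjugating automorphisms fix, the average treats all the terms alike, so no
    indiscernibility of the sequence is needed. *)
Lemma coheir_indep (X : Type) (a : X -> M) D N :
  small K [set: X] -> small K D -> N `<=` D ->
  finitely_satisfiable_in a D N -> R (range a) N D.
Proof.
move=> sX sD ND fs; have sN := small_sub ND sD.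
have [U [UU UN Ua]] := coheir_ultrafilter fs.
apply: indep_of_long_sequence => //; first exact: small_image.
move=> I lt sI wf tr tri.
have [t [ta Rt]] := independent_sequence sD sN sI wf.
pose E := \bigcup_i (t i @` D).
have sE : small K E by apply: small_bigcup => // i; exact: small_image.
pose G : set (formula L (X + E)) :=
  [set phi | U [set f | sat phi (join f (fun d : E => val d))]].
have sV : small K [set: X + E] by apply: small_sum => //; exact/(small_type K E).1.
have [|e eE eG] := @saturated_tuple L K M Hsat _ sV G
    (range inr) (join a (fun d : E => val d)).
  move=> l lG.
  have : U [set f | sat (Conj l) (join f (fun d : E => val d))].
    elim: l lG => [|phi l IH] lG; first by apply: filterS filterT => f _ /=.
    have Ul : U [set f | sat (Conj l) (join f (fun d : E => val d))].
      by apply: IH => psi pl; apply: lG; rewrite inE pl orbT.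
    have Up : G phi by apply: lG; rewrite inE eqxx.
    by apply: filterS (filterI Up Ul) => f [pf lf] /=; apply.
  move=> /filter_ex[f /sat_Conj fl].
  by exists (join f (fun d : E => val d)) => // _ [d _ <-].
pose a' x := e (inl x).
have eJ : e = join a' (fun d : E => val d).
  by apply/funext; case=> // d; rewrite eE //; exists d.
have Et i (d : D) : E (t i (val d)).
  by exists i => //; exists (val d) => //; exact: set_mem (valP d).
have /choice[s sP] i : exists s, automorphism s /\
    s \o join a (fun d : D => val d) = join a' (fun d : D => t i (val d)).
  have [||s sa sj] := @conjugate_tuples L K M Hhom (X + D)%type
      (join a (fun d : D => val d)) (join a' (fun d : D => t i (val d))).
  - by apply: small_sum => //; exact/(small_type K D).1.
  - move=> phi /Ua Uphi.
    pose h (z : X + D) : X + E :=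
      match z with inl x => inl x | inr d => inr (SigSub (mem_set (Et i d))) end.
    have : G (rename phi h).
      apply: filterS (filterI UN Uphi) => f [fN] /=.
      rewrite sat_rename.
      rewrite -(sat_automorphism phi (join f (fun d : D => val d)) (proj1 (ta i))).
      congr sat; apply/funext; case=> //= x; exact: (proj2 (ta i)).
    move=> /eG; rewrite sat_rename eJ; congr sat.
    by apply/funext; case.
  by exists s.
have sX' i x : s i (a x) = a' x := congr1 (@^~ (inl x)) (proj2 (sP i)).
have sD' i (d : D) : s i (val d) = t i (val d) := congr1 (@^~ (inr d)) (proj2 (sP i)).
have sDt i : s i @` D = t i @` D.
  apply/seteqP; split=> _ [x Dx <-]; exists x => //.
    exact/esym/(sD' i (SigSub (mem_set Dx))).
  exact/(sD' i (SigSub (mem_set Dx))).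
exists N, (range a'), s; split=> //.
- move=> i; split; first exact: (proj1 (sP i)).
  move=> x Nx; have := sD' i (SigSub (mem_set (ND _ Nx))) => /= ->.
  exact: (proj2 (ta i)).
- move=> i; apply/seteqP; split=> [_ [_ [x _ <-] <-]|_ [x _ <-]].
    by exists x.
  by exists (a x) => //; exists x.
- move=> i; rewrite sDt setUC; apply: (air_left_normality HR) => //.
  + by apply: small_sub sE => x [j _ jx]; exists j => //; rewrite -sDt.
  + exact: small_image.
  have -> : \bigcup_(j in [set j | lt j i]) (s j @` D) =
            \bigcup_(j in [set j | lt j i]) (t j @` D) by apply: eq_bigcupr => j _.
  exact: Rt.
Qed.

End Independence.

(** * Iterated ultrafilter quantifiers *)

Section IteratedQuantifier.
Variables (T : Type) (U : set_system T) (I : eqType).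
Hypothesis UU : UltraFilter U.
#[local] Existing Instance UU.
Implicit Types (s t : seq I) (g h : I -> T) (P Q : (I -> T) -> Prop).

Definition upd g (i : I) (f : T) : I -> T := fun j => if j == i then f else g j.

(** For [U]-almost all values at the first index of [s], for [U]-almost all values
    at the second one, and so on, [P] holds of the assignment modified from [g]. *)
Fixpoint ultraq s P g : Prop :=
  if s is i :: s' then U [set f | ultraq s' P (upd g i f)] else P g.

Lemma ultra_const (p : Prop) : U [set _ | p] = p.
Proof.
apply/propext; split=> [/filter_ex[]//|pp].
by apply: filterS filterT => f _.
Qed.

Lemma ultra_not (S : set T) : U [set f | ~ S f] = ~ U S.
Proof.
apply/propext; split=> [nS US|nS].
  by have /filter_ex[f []] : U ([set f | ~ S f] `&` S) by exact: filterI.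
by have [//|] := in_ultra_setVsetC S UU.
Qed.

Lemma ultraq_and s P Q g : ultraq s P g -> ultraq s Q g ->
  ultraq s (fun h => P h /\ Q h) g.
Proof.
elim: s g => //= i s IH g Ps Qs.
by apply: filterS (filterI Ps Qs) => f [] /IH; apply.
Qed.

Lemma ultraq_not s P g : ultraq s (fun h => ~ P h) g = ~ ultraq s P g.
Proof.
elim: s g => //= i s IH g; rewrite -ultra_not; congr U; apply/funext => f.
exact: IH.
Qed.

Lemma ultraq_cat s t P g : ultraq (s ++ t) P g = ultraq s (ultraq t P) g.
Proof.
by elim: s g => //= i s IH g; congr U; apply/funext => f; exact: IH.
Qed.

Lemma ultraq_ex (S : set T) s P g : U S -> (forall i, S (g i)) -> ultraq s P g ->
  exists2 h, (forall i, S (h i)) & P h.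
Proof.
move=> US; elim: s g => [|i s IH] g Sg /=; first by exists g.
move=> H; have /filter_ex[f [Sf /IH]] : U (S `&` [set f | ultraq s P (upd g i f)]).
  exact: filterI.
apply=> j.
by rewrite /upd; case: ifP.
Qed.

Lemma ultraq_ext i s P g g' :
  (forall h h', (forall j, j != i -> h j = h' j) -> P h = P h') ->
  (forall j, j != i -> g j = g' j) -> ultraq s P g = ultraq s P g'.
Proof.
move=> Pi; elim: s g g' => [|k s IH] g g' gg /=; first exact: Pi.
congr U; apply/funext => f; apply: IH => j ji; rewrite /upd; case: ifP => // _.
exact: gg.
Qed.

(** At a coordinate on which [P] does not depend the quantifier ranges over a
    constant condition, so it can be dropped. *)
Lemma ultraq_filter (a : pred I) s P g : uniq s ->
  (forall h h', (forall i, (i \notin s) || a i -> h i = h' i) -> P h = P h') ->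
  ultraq s P g = ultraq (seq.filter a s) P g.
Proof.
elim: s g => //= i s IH g /andP[nis us] Pa.
have IH' h : ultraq s P h = ultraq (seq.filter a s) P h.
  apply: IH => // k k' kk; apply: Pa => j; rewrite inE negb_or -orbC.
  by case/orP => [aj|/andP[_ js]]; apply: kk; rewrite ?aj ?orbT ?js.
have -> : [set f | ultraq s P (upd g i f)] =
    [set f | ultraq (seq.filter a s) P (upd g i f)].
  by apply/funext => f; exact: IH'.
case: ifP => //= nai; rewrite -[RHS]ultra_const; congr U; apply/funext => f.
apply: (@ultraq_ext i) => [h h' hh|j /negbTE ji]; last by rewrite /upd ji.
apply: Pa => j; rewrite inE => H; apply: hh; apply: contraTneq H => ->.
by rewrite eqxx nai.
Qed.

Definition depends_on s P : Prop :=
  forall h h', (forall i, i \in s -> h i = h' i) -> P h = P h'.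

(** The quantifiers do not commute, so their indices are listed along [lt]. *)
Section Sorted.
Variable lt : rel I.
Hypotheses (tr : transitive lt) (irr : irreflexive lt).
Hypothesis tri : forall i j, i != j -> lt i j || lt j i.

Lemma sorted_enumeration (s : seq I) : exists2 s', sorted lt s' & s' =i s.
Proof.
pose le i j := (i == j) || lt i j.
have letr : transitive le.
  move=> j i k /orP[/eqP -> //|ij] /orP[/eqP <-|jk]; rewrite /le ?ij ?orbT //.
  by rewrite (tr ij jk) orbT.
have letot : total le.
  by move=> i j; rewrite /le; case: eqVneq => //= /tri.
exists (sort le (undup s)); last by move=> i; rewrite mem_sort mem_undup.
have : pairwise le (sort le (undup s)).
  by rewrite -sorted_pairwise // sort_sorted.
have : pairwise [rel x y | x != y] (sort le (undup s)).
  by rewrite -uniq_pairwise sort_uniq undup_uniq.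
move=> pn pl; rewrite sorted_pairwise //.
have : pairwise [rel x y | (x != y) && le x y] (sort le (undup s)).
  by rewrite pairwise_relI pn.
by apply: sub_pairwise => x y /= /andP[/negbTE xy]; rewrite /le xy.
Qed.

Lemma ultraq_superset s s' P g : sorted lt s -> sorted lt s' -> {subset s <= s'} ->
  depends_on s P -> ultraq s' P g = ultraq s P g.
Proof.
move=> ss ss' sub dep.
rewrite (@ultraq_filter (mem s)) ?(sorted_uniq tr irr) //; last first.
  move=> h h' hh; apply: dep => i si; apply: hh.
  by rewrite inE si orbT.
congr ultraq; apply: (irr_sorted_eq tr irr) => //; first exact: sorted_filter.
by move=> i; rewrite mem_filter inE; apply: andb_idr; exact: sub.
Qed.

End Sorted.
End IteratedQuantifier.

Section Pattern.
Variables (T : Type) (U : set_system T).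

(** The quantifiers without the names of the indices: truth depends only on how
    many of them there are, which is the indiscernibility of the sequences below. *)
Fixpoint ultraq_seq (n : nat) (Q : seq {classic T} -> Prop) : Prop :=
  if n is n'.+1
  then U [set f | ultraq_seq n' (fun l => Q ((f : {classic T}) :: l))]
  else Q [::].

Lemma ultraqE (I : eqType) (s : seq I) (Q : seq {classic T} -> Prop) g : uniq s ->
  ultraq U s (fun h => Q (map (h : I -> {classic T}) s)) g = ultraq_seq (size s) Q.
Proof.
move=> us.
suff gen (t : seq I) : uniq s -> (forall i, i \in s -> i \notin t) ->
   ultraq U s (fun h => Q (map (h : I -> {classic T}) t ++
                           map (h : I -> {classic T}) s)) g =
   ultraq_seq (size s) (fun l => Q (map (g : I -> {classic T}) t ++ l)).
  by rewrite (gen [::]).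
elim: s g t {us} => [|i s IH] g t //= /andP[nis us] st; congr U; apply/funext => f.
transitivity (ultraq U s (fun h => Q (map (h : I -> {classic T}) (rcons t i)
    ++ map (h : I -> {classic T}) s)) (upd g i f)).
  by congr ultraq; apply/funext => h; rewrite map_rcons cat_rcons.
rewrite IH //; last first.
  move=> j js; rewrite mem_rcons inE negb_or st ?inE ?js ?orbT // andbT.
  by apply: contraNneq nis => <-.
congr ultraq_seq; apply/funext => l; rewrite map_rcons cat_rcons /upd eqxx.
congr (Q (_ ++ _)); apply/eq_in_map => j jt; case: eqP => // ji.
by have := st i; rewrite inE eqxx -ji jt => /(_ isT).
Qed.

End Pattern.

(** * Coheir sequences in reverse order *)

Section CoheirSequence.
Variables (L : language) (K : Type) (M : structure L).
Hypothesis HK : strongly_inaccessible K.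
Hypothesis Hsat : saturated K M.
Variables (X : Type) (N : set M) (b : X -> M) (U : set_system (X -> M)).
Hypothesis UU : UltraFilter U.
#[local] Existing Instance UU.
Hypothesis UN : U [set f | forall x, N (f x)].
Hypothesis Ub : forall phi : formula L (X + N),
  sat phi (join b (fun d : N => val d)) ->
  U [set f | sat phi (join f (fun d : N => val d))].
Hypotheses (sX : small K [set: X]) (sN : small K N).

(** The type of [b] over [N] is complete, so it is the whole average of [U]. *)
Lemma ultra_type (phi : formula L (X + N)) :
  U [set f | sat phi (join f (fun d : N => val d))] ->
  sat phi (join b (fun d : N => val d)).
Proof.
move=> H; apply: contrapT => nphi; have := Ub (phi := Not phi) nphi.
by rewrite /= ultra_not; apply.
Qed.

Variable n0 : M.
Hypothesis Nn0 : N n0.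

Section Index.
Variables (I : eqType) (lt : rel I).
Hypotheses (tr : transitive lt) (irr : irreflexive lt).
Hypothesis tri : forall i j, i != j -> lt i j || lt j i.
Hypothesis sI : small K [set: I].

Definition satE (phi : formula L (I * X + N)) (g : I -> X -> M) : Prop :=
  sat phi (join (fun p => g p.1 p.2) (fun d : N => val d)).

(** The outermost quantifier belongs to the smallest index: [c i] realises the
    average of [U] over [N] and the [c j] with [i < j]. The constant assignment is
    overwritten at every index that [phi] mentions. *)
Definition coheir_seq (c : I -> X -> M) : Prop :=
  forall (phi : formula L (I * X + N)) (s : seq I), sorted lt s ->
    depends_on s (satE phi) -> satE phi c = ultraq U s (satE phi) (fun _ _ => n0).

(** Compactness: the formulas prescribed by the iterated quantifiers hold jointly
    for some assignment, since finitely many of them can be quantified along the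
    same increasing list of indices. *)
Lemma coheir_seq_exists : exists c, coheir_seq c.
Proof.
pose g0 (_ : I) (_ : X) := n0.
pose G : set (formula L (I * X + N)) := [set phi | exists s : seq I,
  [/\ sorted lt s, depends_on s (satE phi) & ultraq U s (satE phi) g0]].
have sV : small K [set: I * X + N].
  by apply: small_sum => //; [exact: small_prod|exact/(small_type K N).1].
have [|e eE eG] := @saturated_tuple L K M Hsat _ sV G
    (range inr) (join (fun p => g0 p.1 p.2) (fun d : N => val d)).
  move=> l lG.
  have [s [ss _ sl]] : exists s : seq I,
      [/\ sorted lt s, depends_on s (satE (Conj l)) & ultraq U s (satE (Conj l)) g0].
    elim: l lG => [|phi l IH] lG; first by exists [::]; split=> //; move=> [].
    have [|s [ss sd sl]] := IH.
      by move=> psi pl; apply: lG; rewrite inE pl orbT.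
    have [|s' [ss' sd' sl']] := lG phi; first by rewrite inE eqxx.
    have [t st tE] := sorted_enumeration tr tri (s ++ s').
    have subl : {subset s <= t} by move=> i si; rewrite tE mem_cat si.
    have subr : {subset s' <= t} by move=> i si; rewrite tE mem_cat si orbT.
    have eC h : satE (Conj (phi :: l)) h = (satE phi h /\ satE (Conj l) h).
      apply/propext; rewrite /satE; split=> [/sat_Conj H|[p1 p2]].
        split; first by apply: H; rewrite inE eqxx.
        by apply/sat_Conj => psi pl; apply: H; rewrite inE pl orbT.
      by move=> /=; apply.
    exists t; split=> //.
      move=> h h' hh; rewrite !eC (sd h h') ?(sd' h h') // => i si; apply: hh.
        exact: subr.
      exact: subl.
    have -> : satE (Conj (phi :: l)) = (fun h => satE phi h /\ satE (Conj l) h).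
      by apply/funext.
    apply: ultraq_and; first by rewrite (ultraq_superset UU tr irr g0 ss' st).
    by rewrite (ultraq_superset UU tr irr g0 ss st).
  have [|h _ /sat_Conj hl] := ultraq_ex UU filterT _ sl; first by [].
  by eexists; last exact: hl; move=> _ [d _ <-].
pose c i x := e (inl (i, x)); exists c.
have eJ : e = join (fun p => c p.1 p.2) (fun d : N => val d).
  by apply/funext; case=> [[]//|d]; rewrite eE //; exists d.
have one phi s : sorted lt s -> depends_on s (satE phi) ->
    ultraq U s (satE phi) g0 -> satE phi c.
  by move=> ss sd sU; rewrite /satE -eJ; apply: eG; exists s.
move=> phi s ss sd; apply/propext; split; last exact: one.
move=> pc; apply: contrapT; rewrite -ultraq_not => nU.
apply: (one (Not phi) s ss _ nU pc) => h h' hh.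
by rewrite /satE !sat_Not; congr (~ _); exact: sd.
Qed.

Variable c : I -> X -> M.
Hypothesis cP : coheir_seq c.

Lemma coheir_seq_type i (phi : formula L (X + N)) :
  sat phi (join b (fun d : N => val d)) -> sat phi (join (c i) (fun d : N => val d)).
Proof.
move=> /Ub H; pose phi' : formula L (I * X + N) := rename phi (sum_map (pair i) id).
have phi'P g : satE phi' g = sat phi (join (g i) (fun d : N => val d)).
  by rewrite /satE sat_rename join_sum_map.
rewrite -phi'P (cP (s := [:: i])) //.
  apply: filterS H => f /=; rewrite phi'P /upd eqxx.
  by [].
by move=> h h' hh; rewrite !phi'P hh // inE.
Qed.

(** The index [i] comes last, so its quantifier is the innermost: the quantifiers
    before it range over tuples of [N] and pick [g] in [N] such that [phi (g, f)]
    holds for [U]-almost all [f], that is, such that [phi (g, c i)] holds. *)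
Lemma coheir_seq_below (i : I) :
  finitely_satisfiable_in (fun p : {p : I * X | lt p.1 i} => c (val p).1 (val p).2)
    (N `|` range (c i)) N.
Proof.
pose X' : Type := {p : I * X | lt p.1 i}; pose D := N `|` range (c i).
rewrite -/X' -/D => phi.
have dP (d : D) : ~ N (val d) -> exists x, c i x = val d.
  by have [//|[x _ xd] _] := set_mem (valP d); exists x.
pose code (d : D) : X + N :=
  match pselect (N (val d)) with
  | left Nd => inr (SigSub (mem_set Nd))
  | right nd => inl (projT1 (cid (dP d nd)))
  end.
have codeP d : join (c i) (fun d : N => val d) (code d) = val d.
  by rewrite /code; case: pselect => // nd /=; case: cid.
pose h (z : X' + D) : I * X + N :=
  match z with
  | inl p => inl (val p)
  | inr d => match code d with inl x => inl (i, x) | inr d' => inr d' end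
  end.
have [s0 s0P] := formula_support M phi.
have [s ss sE] := sorted_enumeration tr tri (pmap (fun z : {classic X' + D} =>
  if z is inl p then Some (val p).1 else None) s0).
have sin p : inl p \in s0 -> (val p).1 \in s.
  by move=> ps; rewrite sE mem_pmap; apply/mapP; exists (inl p).
have slt j : j \in s -> lt j i.
  by rewrite sE mem_pmap => /mapP[[p|d] _] // [->]; exact: valP p.
have ssi : sorted lt (s ++ [:: i]).
  rewrite (sorted_pairwise tr) pairwise_cat -!(sorted_pairwise tr) ss /= andbT.
  by apply/allrelP => j k js; rewrite inE => /eqP ->; exact: slt.
have dep : depends_on (s ++ [:: i]) (satE (rename phi h)).
  move=> g g' gg; rewrite /satE !sat_rename; apply: s0P => -[p|d] zs /=.
    by rewrite gg // mem_cat sin.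
  by case: (code d) => //= x; rewrite gg // mem_cat inE eqxx orbT.
have -> : join (fun p : X' => c (val p).1 (val p).2) (fun d : D => val d) =
    join (fun p => c p.1 p.2) (fun d : N => val d) \o h.
  apply/funext; case=> //= d; rewrite -[LHS]codeP.
  by case: (code d).
rewrite -sat_rename -/(satE _ c) (cP ssi dep) ultraq_cat => H.
have [g gN] := ultraq_ex UU UN (fun i x => Nn0) H.
pose k (z : X' + D) : X + N :=
  match z with
  | inl p => inr (SigSub (mem_set (gN (val p).1 (val p).2)))
  | inr d => code d
  end.
move=> {}H; exists (fun p : X' => g (val p).1 (val p).2) => [p|]; first exact: gN.
have /ultra_type/(@coheir_seq_type i) :
    U [set f | sat (rename phi k) (join f (fun d : N => val d))].
  apply: filterS H => f /=; rewrite /satE !sat_rename; congr sat.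
  apply/funext; case=> [p|d] /=; last by case: (code d) => //= x; rewrite /upd eqxx.
  by rewrite /upd; case: eqP => // pi; have := valP p; rewrite /= pi irr.
rewrite sat_rename; congr sat; apply/funext; case=> //= d.
Qed.

Definition jointly_satisfied (Y : Type) (phi : formula L (Y + X))
    (l : seq {classic X -> M}) : Prop :=
  exists a : Y -> M, forall f : X -> M,
    (f : {classic X -> M}) \in l -> sat phi (join a f).

(** Having a common solution is a first-order condition on a finite set of terms,
    so it is governed by the quantifiers along these terms. *)
Lemma coheir_seq_jointly_satisfied (Y : Type) (phi : formula L (Y + X)) (s : seq I) :
  sorted lt s ->
  jointly_satisfied phi (map (c : I -> {classic X -> M}) s) =
  ultraq_seq U (size s) (jointly_satisfied phi).
Proof.
move=> ss.
pose phis : seq {classic formula L (Y + (I * X + N))} :=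
  [seq rename phi (sum_map id (fun x => inl (i, x))) | i <- s].
have [psi psiP] := exists_elim M (Conj phis : formula L (Y + (I * X + N))).
have psiE g : satE psi g = jointly_satisfied phi (map (g : I -> {classic X -> M}) s).
  apply/propext; rewrite /satE psiP; split=> -[a].
    move=> /sat_Conj H; exists a => f /mapP[i si ->].
    have := H _ (map_f _ si); rewrite sat_rename join_sum_map.
    by [].
  move=> H; exists a; apply/sat_Conj => _ /mapP[i si ->].
  by rewrite sat_rename join_sum_map; apply: H; apply/mapP; exists i.
rewrite -psiE (cP ss); last first.
  move=> h h' hh; rewrite !psiE; congr jointly_satisfied.
  exact/eq_in_map.
rewrite -(ultraqE U _ (fun _ _ => n0) (sorted_uniq tr irr ss)).
by congr ultraq; apply/funext => g; exact: psiE.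
Qed.

End Index.
End CoheirSequence.

(** * Non-dividing implies independence *)

Lemma elementary_subset_image (L : language) (M : structure L) (N : set M)
    (s : M -> M) :
  automorphism s -> elementary_subset N -> elementary_subset (s @` N).
Proof.
move=> sa NM phi [m pm]; have [t [ta sK tK]] := automorphism_inv sa.
have h (d : s @` N) : N (t (val d)).
  by have [x Nx <-] := set_mem (valP d); rewrite sK.
have satP m' : sat phi (oapp (fun d : s @` N => val d) (s m')) =
    sat (rename phi (omap (fun d => SigSub (mem_set (h d)) : N)))
      (oapp (fun d : N => val d) m').
  rewrite sat_rename -[RHS](sat_automorphism _ _ sa); congr sat.
  by apply/funext; case=> //= d; rewrite tK.
have [|m' Nm' pm'] := NM (rename phi (omap (fun d => SigSub (mem_set (h d)) : N))).
  by exists (t m); rewrite -satP tK.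
by exists (s m'); [exists m'|rewrite satP].
Qed.

Section Dividing.
Variables (L : language) (K : Type) (M : structure L).
Hypothesis HK : strongly_inaccessible K.
Hypothesis Hsat : saturated K M.
Hypothesis Hhom : strongly_homogeneous K M.

Section Coheir.
Variables (X : Type) (N : set M) (b : X -> M) (U : set_system (X -> M)).
Hypothesis UU : UltraFilter U.
Hypothesis UN : U [set f | forall x, N (f x)].
Hypothesis Ub : forall phi : formula L (X + N),
  sat phi (join b (fun d : N => val d)) ->
  U [set f | sat phi (join f (fun d : N => val d))].
Hypotheses (sX : small K [set: X]) (sN : small K N).
Variable n0 : M.
Hypothesis Nn0 : N n0.

Lemma coheir_seq_conjugate (I : eqType) (lt : rel I) (c : I -> X -> M) (i : I) :
  coheir_seq N U n0 lt c -> exists2 s : M -> M, aut_over N s & s \o b = c i.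
Proof.
move=> cP.
have [||s sa sj] := @conjugate_tuples L K M Hhom (X + N)%type
    (join b (fun d : N => val d)) (join (c i) (fun d : N => val d)).
- by apply: small_sum => //; exact/(small_type K N).1.
- by move=> phi; apply: (coheir_seq_type UU Ub cP).
exists s; last by apply/funext => x; exact: (congr1 (@^~ (inl x)) sj).
split=> // d Nd; exact: (congr1 (@^~ (inr (SigSub (mem_set Nd)))) sj).
Qed.

End Coheir.

(** The sequence indexed by [nat] consists of realisations of the type of the
    parameters over [C], so non-dividing provides [k] of its terms with a common
    solution of [phi]; the right-hand side does not remember which ones. *)
Lemma nondividing_jointly_satisfied (A B C N : set M)
    (U : set_system ((B `|` C : set M) -> M))
    (n0 : M) (phi : formula L (A + (B `|` C))) (k : nat) :
  small K B -> small K C ->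
  UltraFilter U -> U [set f | forall x, N (f x)] ->
  (forall psi : formula L ((B `|` C) + N),
     sat psi (join (fun x : B `|` C => val x) (fun d : N => val d)) ->
     U [set f | sat psi (join f (fun d : N => val d))]) ->
  small K N -> N n0 -> C `<=` N ->
  nondividing A C B ->
  sat phi (join (fun x : A => val x) (fun x : B `|` C => val x)) ->
  ultraq_seq U k (jointly_satisfied phi).
Proof.
move=> sB sC UU UN Ub sN Nn0 CN nd phiA.
have sX : small K [set: (B `|` C : set M)].
  exact/(small_type K _).1/small_setU.
set b := (fun x : (B `|` C : set M) => val x) in Ub phiA.
have ltn_tri (i j : nat) : i != j -> (i < j) || (j < i) by rewrite neq_ltn.
have [c cP] :=
  coheir_seq_exists HK Hsat UU sX sN n0 ltn_trans ltnn ltn_tri (small_nat HK).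
apply: contrapT => nJ; apply: nd.
pose swap (z : A + (B `|` C : set M)) :=
  match z with inl x => inr x | inr y => inl y end.
have [n [g [v gv]]] := finite_left_support M (rename phi swap).
have swapP (a : A -> M) (e : (B `|` C : set M) -> M) : join e a \o swap = join a e.
  by apply/funext; case.
pose phi' : formula L (A + 'I_n.+1) := rename phi (sum_map id g).
pose fin (e : (B `|` C : set M) -> M) (i : 'I_n.+1) : M := oapp e n0 (v i).
have phi'P a e : sat phi (join a e) = sat phi' (join a (fin e)).
  by rewrite -swapP -sat_rename (gv _ _ n0) !sat_rename swapP join_sum_map.
exists n.+1, phi', (fin b); split.
  by move=> a aP; rewrite -phi'P; apply: aP.
exists k, (fun i => fin (c i)); split.
  move=> i psi psib; have [s [sa sN'] sb] := coheir_seq_conjugate UU Ub sX sN i cP.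
  move: psib; rewrite /tp /= -[X in X -> _](sat_automorphism _ _ sa); congr sat.
  apply/funext; case=> [j|d] /=; last exact/sN'/CN/set_mem/(valP d).
  rewrite /fin; case: (v j) => [x|] /=; last exact: sN'.
  exact: (congr1 (@^~ x) sb).
move=> u uinj [a aP]; apply: nJ.
(* [u] is injective but need not be increasing: list its values in order *)
have [s ss sE] := sorted_enumeration ltn_trans ltn_tri (codom u).
have sk : size s = k.
  have us : uniq s := sorted_uniq ltn_trans ltnn ss.
  have uu : uniq (codom u) by rewrite (map_inj_uniq uinj) enum_uniq.
  by rewrite (perm_size (uniq_perm us uu sE)) size_codom card_ord.
rewrite -sk -(coheir_seq_jointly_satisfied ltn_trans ltnn cP phi ss).
exists a => f /mapP[j]; rewrite sE => /codomP[i ->] ->.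
by rewrite phi'P; exact: aP.
Qed.

Variable R : ternary_relation M.
Hypothesis HR : adler_independence K R.

(** The set [C] is absorbed into the parameters: [b] enumerates [B `|` C], so that
    conjugating [b] over [N] fixes [C]. *)
Lemma nondividing_indep (A B C : set M) : countable_language L ->
  small K A -> small K B -> small K C -> nondividing A C B -> R A C B.
Proof.
move=> HL sA sB sC nd.
have sBC : small K (B `|` C) by exact: small_setU.
apply: (right_subset HR sA sC sBC); first exact: subsetUl.
have [N0 [CN0 sN0 N0M]] := downward_Loewenheim_Skolem (M := M) HK HL sC.
have [s0 s0C RN] := indep_existence HK HR sN0 sC sBC.
have NM := elementary_subset_image (proj1 s0C) N0M.
have CN : C `<=` s0 @` N0.
  by rewrite -{1}(aut_over_image s0C); exact: image_subset.
set N := s0 @` N0 in RN NM CN.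
have sN : small K N by exact: small_image.
have [n0 Nn0] : N !=set0.
  have [m0] := carrier_inhabited M.
  by have [|m Nm _] := NM (Equal (Var None) (Var None)); [exists m0|exists m].
pose X : Type := (B `|` C : set M); pose b (x : X) : M := val x.
have sX : small K [set: X] by exact/(small_type K _).1.
have [U [UU UN Ub]] :=
  coheir_ultrafilter
    (elementary_finitely_satisfiable (ex_intro _ n0 Nn0 : N !=set0) NM (a := b)).
apply: (indep_of_long_sequence HK HR) => // I lt sI wf tr tri.
have irr : irreflexive lt.
  move=> i; apply/negP; elim/(well_founded_ind wf): i => i IH ii; exact: (IH i ii ii).
have [c cP] := coheir_seq_exists HK Hsat UU sX sN n0 tr irr tri sI.
have rangeb : range b = B `|` C.
  apply/seteqP; split=> [_ [x _ <-]|x Bx]; first exact: set_mem (valP x).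
  by exists (SigSub (mem_set Bx)).
pose e0 : A + (I * X) -> M := join (fun x : A => val x) (fun p => c p.1 p.2).
pose G : set (formula L (A + (I * X))) := [set psi | exists i phi,
  psi = rename phi (sum_map id (fun x => (i, x))) /\
  sat phi (join (fun x : A => val x) b)].
have sV : small K [set: A + (I * X)].
  by apply: small_sum => //; [exact/(small_type K A).1|exact: small_prod].
(* [e] extends the sequence by a common realisation of all the [tp (A / c i)] *)
have [|e eE eG] := @saturated_tuple L K M Hsat _ sV G (range inr) e0.
  move=> l lG.
  have [phi [s [phiA phiP]]] : exists (phi : formula L (A + X)) (s : seq I),
    sat phi (join (fun x : A => val x) b) /\
    forall psi, psi \in l -> exists2 i, i \in s & exists phi',
      psi = rename phi' (sum_map id (fun x => (i, x))) /\
      forall d : A + X -> M, sat phi d -> sat phi' d.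
    elim: l lG => [|psi l IH] lG; first by exists (Not Bot), [::]; split=> //= [[]].
    have [|phi [s [phiA phiP]]] := IH.
      by move=> psi' pl; apply: lG; rewrite inE pl orbT.
    have [|i [phi' [psiE phi'A]]] := lG psi; first by rewrite inE eqxx.
    exists (And phi' phi), (i :: s); split; first by move=> /(_ phi'A); apply.
    have AndP d : sat (And phi' phi) d -> sat phi' d /\ sat phi d.
      move=> H; split; apply: contrapT => H'; apply: H => //.
    move=> psi'; rewrite inE => /orP[/eqP ->|/phiP[j js [phi'' [-> H]]]].
      exists i; first by rewrite inE eqxx.
      by exists phi'; split=> // d /AndP[].
    exists j; first by rewrite inE js orbT.
    by exists phi''; split=> // d /AndP[_]; exact: H.
  have [s' ss' sE'] := sorted_enumeration tr tri s.
  have := nondividing_jointly_satisfied (size s') sB sC UU UN Ub sN Nn0 CN nd phiA.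
  rewrite -(coheir_seq_jointly_satisfied tr irr cP phi ss') => -[a aP].
  exists (join a (fun p => c p.1 p.2)) => [_ [p _ <-] //|psi /phiP[i si [phi' [-> H]]]].
  rewrite sat_rename join_sum_map; apply: H; apply: aP.
  by apply/mapP; exists i => //; rewrite sE'.
pose a' x := e (inl x).
have eJ : e = join a' (fun p => c p.1 p.2).
  by apply/funext; case=> // p; rewrite eE //; exists p.
have /choice[s sP] i : exists s, automorphism s /\
    s \o join (fun x : A => val x) b = join a' (c i).
  have [||s sa sj] := @conjugate_tuples L K M Hhom (A + X)%type
      (join (fun x : A => val x) b) (join a' (c i)).
  - by apply: small_sum => //; exact/(small_type K A).1.
  - move=> phi phiA.
    have : sat (rename phi (sum_map id (fun x => (i, x)))) e.
      by apply: eG; exists i, phi.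
    by rewrite sat_rename eJ join_sum_map.
  by exists s.
have sA' i (x : A) : s i (val x) = a' x := congr1 (@^~ (inl x)) (proj2 (sP i)).
have sB' i (x : X) : s i (val x) = c i x := congr1 (@^~ (inr x)) (proj2 (sP i)).
have cconj i := coheir_seq_conjugate UU Ub sX sN i cP.
have range_c i : s i @` (B `|` C) = range (c i).
  rewrite -rangeb image_comp; congr (_ @` _).
  by apply/funext => x; exact: sB'.
exists N, (range a'), s; split=> //.
- move=> i; split; first exact: (proj1 (sP i)).
  move=> x Cx; have [t [_ tN] tb] := cconj i.
  pose x' : X := SigSub (mem_set (or_intror Cx : (B `|` C) x)).
  rewrite -[x]/(val x') sB' -tb; exact/tN/CN.
- move=> i; apply/seteqP; split=> [_ [x Ax <-]|_ [x _ <-]].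
    by exists (SigSub (mem_set Ax)) => //; exact/esym/(sA' i (SigSub (mem_set Ax))).
  by exists (val x); [exact: set_mem (valP x)|exact: sA'].
move=> i; rewrite range_c.
have sr j : small K (range (c j)) by exact: small_image.
pose X' : Type := {p : I * X | lt p.1 i}.
have below : \bigcup_(j in [set j | lt j i]) (s j @` (B `|` C)) =
    range (fun p : X' => c (val p).1 (val p).2).
  apply/seteqP; split=> [y [j ji]|_ [p _ <-]].
    by rewrite range_c => -[x _ <-]; exists (exist _ (j, x) ji).
  by exists (val p).1; [exact: valP p|rewrite range_c; exists (val p).2].
rewrite below; set E := range (fun p : X' => _).
have sX' : small K [set: X'].
  apply: (small_inj (f := fun p : X' => val p)); first exact: val_inj.
  exact: small_prod.
have sE : small K E by exact: small_image.
have RE : R E N (range (c i)).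
  apply: (right_subset HR (D := N `|` range (c i))) => //.
  - exact: small_setU.
  apply: (coheir_indep HK Hsat Hhom HR) => //.
  - exact: small_setU.
  exact: (coheir_seq_below UU UN Ub Nn0 tr irr tri cP).
have RNc : R N C (range (c i)).
  have [t tN tb] := cconj i.
  have tC : aut_over C t by split=> [|x Cx]; [exact: (proj1 tN)|exact/(proj2 tN)/CN].
  move: RN; rewrite (aut_over_indep HR sN sBC sC tC) (aut_over_image tN).
  by rewrite -rangeb image_comp tb.
rewrite setUC; apply: (air_left_transitivity HR (B := N)) => //.
- exact: small_setU.
- exact: (air_left_normality HR).
Qed.

End Dividing.

Theorem proposition4p1p7
  (L : language) (HL : countable_language L)
  (T : set (sentence L)) (HT : complete_theory T)
  (HTinf : only_infinite_models T)
  (K : Type) (HK : strongly_inaccessible K)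
  (M : structure L) (HM : monster T K M)
  (R : ternary_relation M) (HR : adler_independence K R)
  (A B C : set M)
  (HA : small K A) (HB : small K B) (HC : small K C) :
  nondividing A C B -> R A C B.
Proof.
have [_ _ Hsat Hhom] := HM.
exact: (nondividing_indep HK Hsat Hhom HR).
Qed.
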